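(* Let $\Phi:\mathbb{C}^{n\times n}\to\mathbb{C}^{m\times m}$ be a completely positive map whose $p$ Kraus operators have Gaussian integer entries, let $\alpha\in\mathbb{R}^n,\beta\in\mathbb{R}^m$ be nonincreasing and $k\ge 0$. Then either $\operatorname{cap}_k^{\alpha,\beta}\Phi=-\infty$, or $-\operatorname{cap}_k^{\alpha,\beta}\Phi=O(k(n+m)\log(m+n)+k\log p)$.
   Context: $\Phi(X)=\sum_{i=1}^pA_iXA_i^\dagger$ with $A_i\in\mathbb{C}^{m\times n}$. $\lambda(H)$ is the vector of eigenvalues of a Hermitian $H$ in nonincreasing order. With $\mathcal{D}=\{(X,Y,z):X\succeq I_n,Y\succeq I_m\text{ Hermitian},z\ge0\}$, $f_k^{\alpha,\beta}(X,Y,z)=\operatorname{Tr}\Phi(X^{-1})Y^{-1}e^z+\alpha\cdot\lambda(\log X)+\beta\cdot\lambda(\log Y)-kz$ and $\operatorname{cap}_k^{\alpha,\beta}\Phi=\inf_{\mathcal{D}}f_k^{\alpha,\beta}$.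
   Formalization: The implied constant is absolute only for k ≤ exp(M((n+m)log(m+n)+log p)) and depends on M; without such a bound the claim fails, e.g. n=m=p=1, A=1, α=β=k gives -cap = k log k - k. Also n, m, p ≥ 1. *)

(* Defs.v *)
From mathcomp Require Import all_boot all_order all_algebra spectral sesquilinear.
From mathcomp Require Import complex.
From mathcomp Require Import boolp classical_sets reals ereal sequences exp.

Set Implicit Arguments.
Unset Strict Implicit.
Unset Printing Implicit Defensive.

Import Order.TTheory GRing.Theory Num.Theory.
Local Open Scope ring_scope.
Local Open Scope complex_scope.
Local Open Scope sesquilinear_scope.

Section Capacity.
Variable R : realType.
Local Notation C := R[i].

Definition gaussian_integer (c : C) : Prop :=
  complex.Re c \is a Num.int /\ complex.Im c \is a Num.int.

Definition kraus_map (m n p : nat) (A : 'I_p -> 'M[C]_(m, n))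
    (X : 'M[C]_n) : 'M[C]_m :=
  \sum_(i < p) A i *m X *m (A i)^t*.

Definition psdmx (n : nat) (H : 'M[C]_n) : Prop :=
  H \is hermsymmx /\ forall v : 'cV[C]_n, 0 <= (v^t* *m H *m v) ord0 ord0.

Definition loewner_le (n : nat) (H K : 'M[C]_n) : Prop := psdmx (K - H).

(* spectral_diag lists the eigenvalues with multiplicity, in no particular
   order; for a Hermitian matrix they are real. *)
Definition eigvals (n : nat) (H : 'M[C]_n) : 'rV[R]_n :=
  \row_(i < n)
    (sort >=%R [seq complex.Re (spectral_diag H ord0 j) | j : 'I_n])`_i.

(* Logarithm by spectral calculus: if X = P^-1 diag(d) P with P unitary, then
   log X = P^-1 diag(ln d) P. Meaningful for X Hermitian positive definite. *)
Definition logmx (n : nat) (X : 'M[C]_n) : 'M[C]_n :=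
  invmx (spectralmx X)
    *m diag_mx (\row_(i < n) (ln (complex.Re (spectral_diag X ord0 i)))%:C)
    *m spectralmx X.

Definition dotr (n : nat) (u v : 'rV[R]_n) : R :=
  \sum_(i < n) u ord0 i * v ord0 i.

Definition nonincreasing_vec (n : nat) (u : 'rV[R]_n) : Prop :=
  forall i j : 'I_n, (i <= j)%N -> u ord0 j <= u ord0 i.

Definition cap_dom (n m : nat) : set ('M[C]_n * 'M[C]_m * R) :=
  fun XYz => let: (X, Y, z) := XYz in
    [/\ X \is hermsymmx, Y \is hermsymmx,
        loewner_le 1%:M X, loewner_le 1%:M Y & 0 <= z].

(* On cap_dom the trace is a nonnegative real, so taking its real part only
   changes the type. *)
Definition cap_obj (m n p : nat) (A : 'I_p -> 'M[C]_(m, n))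
    (alpha : 'rV[R]_n) (beta : 'rV[R]_m) (k : R)
    (XYz : 'M[C]_n * 'M[C]_m * R) : R :=
  let: (X, Y, z) := XYz in
  complex.Re (\tr (kraus_map A (invmx X) *m invmx Y)) * expR z
    + dotr alpha (eigvals (logmx X)) + dotr beta (eigvals (logmx Y)) - k * z.

Definition cap (m n p : nat) (A : 'I_p -> 'M[C]_(m, n))
    (alpha : 'rV[R]_n) (beta : 'rV[R]_m) (k : R) : \bar R :=
  ereal_inf [set (cap_obj A alpha beta k XYz)%:E | XYz in @cap_dom n m]%classic.

End Capacity.

(* Main.v *)
(** The Kraus operators are integral, so every nonzero entry of H^* A_l G with
    G, H unimodular over Z[i] has modulus at least 1.  Given (X, Y, z) in the
    domain, reduce the Hermitian form X on the lattice Z[i]^n: there is a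
    unimodular G with G^* X G = T^* D T, T unitriangular with entries of modulus
    at most 1 and D_i <= 4^(j-i) D_j for i <= j; likewise H for Y.  Up to a factor
    exp(O((n+m) log(n+m))), the trace term is then bounded below by
    1/(D_j E_i) for every (i, j) in the support of the H^* A_l G.  Covolumes of
    sublattices of Z[i]^n are at least 1, so the vector log D is majorized by
    the spectrum of log X; after a small monotone correction it becomes a
    point x of the cone of nonincreasing nonnegative vectors with
    alpha.x <= alpha.lambda(log X), and similarly y for Y.  If the capacity is
    not -oo, following the flags of G and H to infinity shows
    k t <= alpha.x + beta.y for t the minimum of x_j + y_i over the support.
    Hence the objective is at least c exp(z - t) + k t - k z, and minimizing
    over z gives -cap <= k log k - k log c. *)

Require Import Defs.
From mathcomp Require Import all_boot all_order all_algebra perm.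
From mathcomp Require Import spectral sesquilinear complex.
From mathcomp Require Import boolp classical_sets reals ereal topology normedtype.
From mathcomp Require Import sequences exp.
From mathcomp Require Import ring lra zify.

Set Implicit Arguments.
Unset Strict Implicit.
Unset Printing Implicit Defensive.

Import Order.TTheory GRing.Theory Num.Theory.
Import numFieldNormedType.Exports.
Local Open Scope ring_scope.
Local Open Scope sesquilinear_scope.

(** * Adjoints, positive Hermitian forms and their triangular factorization *)

Section Adjoint.
Variable C : numClosedFieldType.

Lemma adjmxM m n p (A : 'M[C]_(m, n)) (B : 'M[C]_(n, p)) :
  (A *m B)^t* = B^t* *m A^t*.
Proof. by rewrite trmx_mul map_mxM. Qed.

Lemma adjmx1 n : (1%:M : 'M[C]_n)^t* = 1%:M.
Proof. by rewrite trmx1 map_mx1. Qed.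

Lemma adjmxE m n (A : 'M[C]_(m, n)) i j : A^t* i j = (A j i)^*.
Proof. by rewrite !mxE. Qed.

Lemma det_adjmx n (A : 'M[C]_n) : \det (A^t*) = (\det A)^*.
Proof. by rewrite det_map_mx det_tr. Qed.

Lemma adj_block m1 m2 n1 n2 (A : 'M[C]_(m1, n1)) (B : 'M[C]_(m1, n2))
    (D : 'M[C]_(m2, n1)) (E : 'M[C]_(m2, n2)) :
  (block_mx A B D E)^t* = block_mx (A^t*) (D^t*) (B^t*) (E^t*).
Proof. by rewrite tr_block_mx map_block_mx. Qed.

Lemma hermP n (M : 'M[C]_n) : reflect (M^t* = M) (M \is hermsymmx).
Proof. by rewrite is_hermitianmxE expr0 scale1r; apply: (iffP eqP). Qed.

Lemma hermE n (M : 'M[C]_n) i j : M^t* = M -> (M i j)^* = M j i.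
Proof. by move=> {2}<-; rewrite adjmxE. Qed.

Definition sqnorm n (v : 'cV[C]_n) : C := (v^t* *m v) 0 0.

Lemma sqnormE n (v : 'cV[C]_n) : sqnorm v = \sum_i `|v i 0| ^+ 2.
Proof.
by rewrite /sqnorm mxE; apply: eq_bigr => i _; rewrite adjmxE normCK mulrC.
Qed.

Lemma sqnorm_ge0 n (v : 'cV[C]_n) : 0 <= sqnorm v.
Proof. by rewrite sqnormE sumr_ge0 // => i _; rewrite exprn_ge0. Qed.

(** A quantitative form of positive definiteness: [eps] survives unchanged in Schur complements and
    bounds the form away from 0 on nonzero lattice vectors. *)
Definition coercive n (eps : C) (M : 'M[C]_n) :=
  forall v : 'cV[C]_n, eps * sqnorm v <= (v^t* *m M *m v) 0 0.

Definition unitriu n (T : 'M[C]_n) :=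
  forall i j : 'I_n, (j <= i)%N -> T i j = (i == j)%:R.

Lemma unitriu_block n (r : 'rV[C]_n) (T : 'M[C]_n) :
  unitriu T -> unitriu (block_mx 1%:M r 0 T : 'M[C]_(1 + n)).
Proof.
move=> hT i j; case: (split_ordP i) => [i1 ->|i2 ->].
  case: (split_ordP j) => [j1 ->|j2 ->] /=; last by rewrite (ord1 i1).
  by rewrite block_mxEul !ord1 mxE !eqxx.
case: (split_ordP j) => [j1 ->|j2 ->] /=.
  by move=> _; rewrite block_mxEdl mxE eq_sym eq_lrshift.
by rewrite leq_add2l block_mxEdr eq_rshift; apply: hT.
Qed.

Lemma unitriu_det n (T : 'M[C]_n) : unitriu T -> \det T = 1.
Proof.
move=> hT; rewrite -det_tr det_trig.
  by rewrite big1 // => i _; rewrite mxE hT // eqxx.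
apply/is_trig_mxP => i j ij; rewrite mxE hT ?(ltnW ij) //.
by case: eqVneq ij => // ->; rewrite ltnn.
Qed.

Lemma unitriu_unit n (T : 'M[C]_n) : unitriu T -> T \in unitmx.
Proof. by move=> hT; rewrite unitmxE unitriu_det // unitr1. Qed.

Definition trimx m (T : 'M[C]_m) := forall i j : 'I_m, (j < i)%N -> T i j = 0.

Lemma unitriu_tri n (T : 'M[C]_n) : unitriu T -> trimx T.
Proof.
move=> hT i j ij; rewrite hT ?(ltnW ij) //.
by case: eqVneq ij => // ->; rewrite ltnn.
Qed.

(** One step of symmetric elimination with pivot [M 0 0]. Each [w] extends to a vector [v] whose
    pivot coordinate is annihilated, so the form [S] at [w] is the form [M] at [v]; as [v] is at
    least as long as [w], the same [eps] serves for [S]. *)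
Lemma schur_complement n (M : 'M[C]_(1 + n)) eps :
  0 < eps -> M^t* = M -> coercive eps M ->
  exists (r : 'rV[C]_n) (S : 'M[C]_n),
    [/\ S^t* = S, coercive eps S, eps <= M 0 0 &
       M = (block_mx 1%:M r 0 1%:M)^t* *m block_mx (M 0 0)%:M 0 0 S
             *m block_mx 1%:M r 0 1%:M].
Proof.
move=> e0 hM cM.
have ea : eps <= M 0 0.
  have := cM (delta_mx 0 0).
  rewrite sqnormE (bigD1 0) //= big1 => [|i i0]; last first.
    by rewrite mxE (negPf i0) normr0 expr0n.
  rewrite mxE eqxx normr1 expr1n addr0 mulr1.
  by rewrite trmx_delta map_delta_mx -rowE -colE !mxE.
have a0 : 0 < M 0 0 by apply: lt_le_trans ea.
set a := M 0 0 in ea a0 *.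
have aJ : a^* = a by rewrite hermE.
pose c := ursubmx M.
have ul : ulsubmx M = a%:M.
  by apply/matrixP=> i j; rewrite !ord1 !mxE !lshift0 eqxx mulr1n.
have dl : dlsubmx M = c^t*.
  by rewrite -{1}hM -{1}[M]submxK adj_block block_mxKdl.
have dr : (drsubmx M)^t* = drsubmx M.
  by rewrite -{2}hM -{2}[M]submxK adj_block block_mxKdr.
pose S := drsubmx M - a^-1 *: (c^t* *m c).
have eqM : M = (block_mx 1%:M (a^-1 *: c) 0 1%:M)^t* *m block_mx a%:M 0 0 S
             *m block_mx 1%:M (a^-1 *: c) 0 1%:M.
  rewrite adj_block !adjmx1 trmx0 map_mx0 !mulmx_block.
  rewrite !(mul1mx, mul0mx, mulmx0, mulmx1, addr0, add0r).
  rewrite !linearZ /= map_mxZ /= fmorphV /= aJ mul_scalar_mx scalerA.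
  rewrite mul_mx_scalar scalerA mulVf ?mulfV ?gt_eqF // !scale1r.
  by rewrite /S addrC subrK -[LHS]submxK ul dl.
have hS : S^t* = S.
  rewrite /S linearB /= map_mxB dr !linearZ /= map_mxZ /= fmorphV /= aJ.
  by rewrite adjmxM trmxCK scalerN.
exists (a^-1 *: c), S; split => // w.
pose T := block_mx 1%:M (a^-1 *: c) 0 1%:M : 'M[C]_(1 + n).
pose v : 'cV[C]_(1 + n) := col_mx (- (a^-1 *: c) *m w) w.
have Tv : T *m v = col_mx 0 w.
  by rewrite mul_block_col !mul1mx mul0mx add0r mulNmx addNr.
have := cM v; rewrite eqM -/T.
rewrite !mulmxA -adjmxM -[_ *m T *m v]mulmxA Tv.
rewrite tr_col_mx map_row_mx trmx0 map_mx0 mul_row_block mul_row_col.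
rewrite !(mul0mx, mulmx0, add0r).
apply: le_trans; rewrite ler_pM2l // !sqnormE big_split_ord /=.
under [X in _ <= _ + X]eq_bigr do rewrite col_mxEd.
by rewrite lerDr sumr_ge0 // => i _; rewrite exprn_ge0.
Qed.

Lemma diag_mx11 (a : C) : diag_mx (a%:M : 'rV[C]_1) = a%:M.
Proof. by apply/matrixP=> i j; rewrite !ord1 !mxE !eqxx. Qed.

Lemma ldl_exists n (M : 'M[C]_n) eps : 0 < eps -> M^t* = M -> coercive eps M ->
  exists (T : 'M[C]_n) (d : 'rV[C]_n),
    [/\ unitriu T, forall i, 0 < d 0 i & M = T^t* *m diag_mx d *m T].
Proof.
move=> e0; elim: n M => [|n IH] M hM cM.
  exists 1%:M, 0; split=> [[]//|[]//|].
  by apply/matrixP => -[].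
have [r [S [hS cS ea eqM]]] := @schur_complement n M eps e0 hM cM.
have [T [d [hT d0 eqS]]] := IH S hS cS.
have eqT : M = (block_mx 1%:M r 0 T : 'M_(1 + n))^t*
      *m diag_mx (row_mx (M 0 0)%:M d) *m block_mx 1%:M r 0 T.
  rewrite {1}eqM diag_mx_row diag_mx11 eqS !adj_block !adjmx1 trmx0 map_mx0.
  by rewrite !mulmx_block !(mul1mx, mul0mx, mulmx0, mulmx1, addr0, add0r).
exists (block_mx 1%:M r 0 T : 'M_(1 + n)), (row_mx (M 0 0)%:M d : 'rV_(1 + n)).
split; [exact: unitriu_block| |exact: eqT].
move=> i; case: (@split_ordP 1 n i) => [j ->|j ->].
  by rewrite (@row_mxEl _ 1 1 n) ord1 mxE eqxx mulr1n (lt_le_trans e0).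
by rewrite (@row_mxEr _ 1 1 n).
Qed.

End Adjoint.

(** * The Cauchy-Binet formula *)

(** Each row of the product is a combination of rows of [B]; multilinearity of the determinant
    selects one row [f r] for each [r]. *)
Lemma det_mulmx_rect (K : comNzRingType) s n (A : 'M[K]_(s, n)) (B : 'M[K]_(n, s)) :
  \det (A *m B) = \sum_(f : {ffun 'I_s -> 'I_n})
     (\prod_r A r (f r)) * \det (\matrix_(r, c) B (f r) c).
Proof.
rewrite /determinant.
transitivity (\sum_(t : 'S_s) \sum_(f : {ffun 'I_s -> 'I_n})
    (-1) ^+ t * \prod_r (A r (f r) * B (f r) (t r))).
  apply: eq_bigr => t _; rewrite -big_distrr /=; congr (_ * _).
  rewrite -(bigA_distr_bigA (fun r k => A r k * B k (t r))) /=.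
  by apply: eq_bigr => r _; rewrite mxE.
rewrite exchange_big /=; apply: eq_bigr => f _; rewrite big_distrr /=.
apply: eq_bigr => t _; rewrite big_split /= mulrCA; do 2 congr (_ * _).
by apply: eq_bigr => r _; rewrite mxE.
Qed.

(* The sum runs over all maps, not only increasing ones, hence the factorial. *)
Lemma cauchy_binet (K : comNzRingType) s n (A : 'M[K]_(s, n)) (B : 'M[K]_(n, s)) :
  s`!%:R * \det (A *m B) = \sum_(f : {ffun 'I_s -> 'I_n})
     \det (\matrix_(r, c) A r (f c)) * \det (\matrix_(r, c) B (f r) c).
Proof.
(* Reindexing by composition with [t] moves the sign of [t] onto the product of entries of [A].
   Summing over all [t] then rebuilds the minor of [A]. *)
have step (t : 'S_s) : \det (A *m B) = \sum_(f : {ffun 'I_s -> 'I_n})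
    ((-1) ^+ t * \prod_r A r (f (t r))) * \det (\matrix_(r, c) B (f r) c).
  rewrite det_mulmx_rect.
  pose h (t' : 'S_s) (f : {ffun 'I_s -> 'I_n}) := [ffun r => f (t' r)].
  rewrite (reindex (h t)) /=; last first.
    exists (h t^-1%g) => f _; apply/ffunP => r; rewrite !ffunE.
      by rewrite permKV.
    by rewrite permK.
  apply: eq_bigr => f _.
  have -> : (\matrix_(r, c) B (h t f r) c) =
            row_perm t (\matrix_(r, c) B (f r) c).
    by apply/matrixP => r c; rewrite !mxE ffunE.
  rewrite row_permE det_mulmx det_perm mulrA [_ * (-1) ^+ _]mulrC.
  by congr (_ * _ * _); apply: eq_bigr => r _; rewrite ffunE.
have -> : s`!%:R * \det (A *m B) = \sum_(t : 'S_s) \det (A *m B).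
  by rewrite sumr_const card_Sn mulr_natl.
under eq_bigr => t _ do rewrite (step t).
rewrite exchange_big /=; apply: eq_bigr => f _; rewrite -big_distrl /=.
congr (_ * _); apply: eq_bigr => t _; congr (_ * _).
by apply: eq_bigr => r _; rewrite !mxE.
Qed.

(** * Gram determinants, leading pivots and entries of triangular congruences *)

Section Gram.
Variable C : numClosedFieldType.

Lemma det_weighted_gram s n (B : 'M[C]_(n, s)) (l : 'rV[C]_n) :
  s`!%:R * \det (B^t* *m diag_mx l *m B) = \sum_(f : {ffun 'I_s -> 'I_n})
     (\prod_r l 0 (f r)) * `|\det (\matrix_(r, c) B (f r) c)| ^+ 2.
Proof.
rewrite cauchy_binet; apply: eq_bigr => f _.
set Bf := \matrix_(r, c) B (f r) c.
have -> : \matrix_(r, c) (B^t* *m diag_mx l) r (f c) =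
          Bf^t* *m diag_mx (\row_r l 0 (f r)).
  by apply/matrixP => r c; rewrite !mul_mx_diag !mxE.
rewrite det_mulmx det_adjmx det_diag normCK mulrAC [RHS]mulrC.
rewrite [(\det Bf)^* * _]mulrC; congr (_ * _).
by apply: eq_bigr => r _; rewrite mxE.
Qed.

Lemma det_gram s n (B : 'M[C]_(n, s)) :
  s`!%:R * \det (B^t* *m B) = \sum_(f : {ffun 'I_s -> 'I_n})
     `|\det (\matrix_(r, c) B (f r) c)| ^+ 2.
Proof.
have := det_weighted_gram B (const_mx 1).
rewrite diag_const_mx mulmx1 => ->; apply: eq_bigr => f _.
by rewrite big1 ?mul1r // => r _; rewrite mxE.
Qed.

Lemma fact_gt0C s : 0 < s`!%:R :> C.
Proof. by rewrite ltr0n fact_gt0. Qed.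

Lemma det_gram_ge0 s n (B : 'M[C]_(n, s)) : 0 <= \det (B^t* *m B).
Proof.
rewrite -(pmulr_rge0 _ (fact_gt0C s)) det_gram.
by apply: sumr_ge0 => f _; rewrite exprn_ge0.
Qed.

(** A zero Gram determinant is a vanishing sum of squared moduli, so all maximal minors of [B] are
    zero. *)
Lemma det_gram_eq0 s n (B : 'M[C]_(n, s)) (l : 'rV[C]_n) :
  \det (B^t* *m B) = 0 -> \det (B^t* *m diag_mx l *m B) = 0.
Proof.
move=> B0; have /eqP := det_gram B; rewrite B0 mulr0 eq_sym psumr_eq0; last first.
  by move=> f _; rewrite exprn_ge0.
move=> /allP h; have /eqP := det_weighted_gram B l.
rewrite big1 => [|f _]; last first.
  by have /= := h f (mem_index_enum f) => /eqP ->; rewrite mulr0.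
by rewrite mulf_eq0 gt_eqF ?fact_gt0C //= => /eqP.
Qed.

(** Cauchy-Binet termwise: a selection [f] that repeats a row has minor 0, so it suffices to bound
    the weights of injective selections. *)
Lemma le_det_weighted_gram s n (B : 'M[C]_(n, s)) (l : 'rV[C]_n) (mu : C) :
  (forall f : 'I_s -> 'I_n, injective f -> mu <= \prod_r l 0 (f r)) ->
  mu * \det (B^t* *m B) <= \det (B^t* *m diag_mx l *m B).
Proof.
move=> hmu; rewrite -(ler_pM2l (fact_gt0C s)) mulrCA det_gram det_weighted_gram.
rewrite big_distrr /=; apply: ler_sum => f _.
have [/injectiveP inj_f|] := boolP (injectiveb f).
  by apply: ler_wpM2r; [rewrite exprn_ge0|apply: hmu].
case/injectivePn => i [j ij fij].
rewrite (determinant_alternate ij) ?normr0 ?expr0n ?mulr0 //.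
by move=> c; rewrite !mxE fij.
Qed.

Lemma colsub1E n s (hs : (s <= n)%N) m (M : 'M[C]_(m, n)) :
  M *m colsub (widen_ord hs) 1%:M = colsub (widen_ord hs) M.
Proof.
apply/matrixP => i j; rewrite !mxE (bigD1 (widen_ord hs j)) //= big1.
  by rewrite !mxE eqxx mulr1 addr0.
by move=> k kj; rewrite !mxE (negPf kj) mulr0.
Qed.

(** An upper triangular matrix preserves the span of the first [s] coordinate vectors and acts there
    through its leading block. *)
Lemma colsub_unitriu n s (hs : (s <= n)%N) (T : 'M[C]_n) : unitriu T ->
  colsub (widen_ord hs) T =
  colsub (widen_ord hs) 1%:M *m mxsub (widen_ord hs) (widen_ord hs) T.
Proof.
move=> hT; apply/matrixP => i j; rewrite !mxE.
have [si|is_] := leqP s i.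
  rewrite big1 => [|k _].
    rewrite hT /=; last by rewrite (leq_trans _ si) // ltnW.
    by rewrite -val_eqE /= gtn_eqF // (leq_trans _ si).
  by rewrite !mxE -val_eqE /= gtn_eqF ?mul0r // (leq_trans _ si).
rewrite (bigD1 (Ordinal is_)) //= big1 => [|k /negPf kj].
  rewrite !mxE; have -> : widen_ord hs (Ordinal is_) = i by apply: val_inj.
  by rewrite eqxx mul1r addr0.
by rewrite !mxE -val_eqE /= eq_sym; move: kj; rewrite -val_eqE /= => ->; rewrite mul0r.
Qed.

(** The left side is the Gram determinant, for the form [M], of the first [s] columns of [G]. The
    leading block of [T] has determinant 1, so only the pivots remain. *)
Lemma det_leading_ldl n s (hs : (s <= n)%N) (T G M : 'M[C]_n) (d : 'rV[C]_n) :
  unitriu T -> G^t* *m M *m G = T^t* *m diag_mx d *m T ->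
  \det ((colsub (widen_ord hs) G)^t* *m M *m colsub (widen_ord hs) G) =
  \prod_(r < s) d 0 (widen_ord hs r).
Proof.
move=> hT eqM; pose J : 'M[C]_(n, s) := colsub (widen_ord hs) 1%:M.
rewrite -colsub1E -/J adjmxM -!mulmxA (mulmxA M) (mulmxA (G^t*)) (mulmxA (G^t*)).
rewrite eqM.
pose Ts := mxsub (widen_ord hs) (widen_ord hs) T.
have TJ : T *m J = J *m Ts by rewrite colsub1E colsub_unitriu.
rewrite -!mulmxA TJ (mulmxA (J^t*)) -adjmxM TJ adjmxM -!mulmxA.
rewrite (mulmxA _ J) (mulmxA (J^t*)).
have -> : J^t* *m (diag_mx d *m J) = diag_mx (\row_r d 0 (widen_ord hs r)).
  rewrite mulmxA colsub1E; apply/matrixP => i j.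
  rewrite mul_mx_diag !mxE conjC_nat mulr_natl -val_eqE /= eq_sym val_eqE.
  by case: eqVneq => // ->.
have Ts1 : \det Ts = 1.
  apply: unitriu_det => i j ij; rewrite !mxE hT //.
rewrite !det_mulmx det_adjmx Ts1 conjC1 mul1r mulr1 det_diag.
by apply: eq_bigr => r _; rewrite mxE.
Qed.

Lemma trace_kraus_diag m n (A : 'M[C]_(m, n)) (U : 'M[C]_n) (V : 'M[C]_m)
    (p : 'rV[C]_n) (q : 'rV[C]_m) :
  \tr (A *m (U *m diag_mx p *m U^t*) *m A^t* *m (V *m diag_mx q *m V^t*)) =
  \sum_a \sum_b `|(V^t* *m A *m U) a b| ^+ 2 * (p 0 b * q 0 a).
Proof.
set B := V^t* *m A *m U.
have BE : B^t* = U^t* *m A^t* *m V by rewrite !adjmxM trmxCK mulmxA.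
rewrite !mulmxA mxtrace_mulC !mulmxA -/B.
have -> : B *m diag_mx p *m U^t* *m A^t* *m V *m diag_mx q =
          B *m diag_mx p *m B^t* *m diag_mx q by rewrite BE !mulmxA.
apply: eq_bigr => a _; rewrite mul_mx_diag !mxE big_distrl /=.
apply: eq_bigr => b _.
by rewrite mul_mx_diag mxE adjmxE normCK; ring.
Qed.

(** By triangularity the entry at [i], [j] is a sum of at most [m * n] terms, each bounded by some
    [B a b] with [a <= i] and [b <= j]. Having modulus at least 1, it forces one of these to have
    modulus at least the inverse of [m * n]; the growth bounds on [p] and [q] compare the weights
    there with those at [j] and [i]. *)
Lemma tri_entry_bound m n (K : 'M[C]_m) (L : 'M[C]_n) (B : 'M[C]_(m, n))
    (p : 'rV[C]_n) (q : 'rV[C]_m) (cp cq : C) i j :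
  unitriu K -> unitriu L ->
  (forall a b, `|K a b| <= 1) -> (forall a b, `|L a b| <= 1) ->
  (forall b, 0 < p 0 b) -> (forall a, 0 < q 0 a) ->
  (forall b c : 'I_n, (b <= c)%N -> p 0 c <= cp * p 0 b) ->
  (forall a c : 'I_m, (a <= c)%N -> q 0 c <= cq * q 0 a) ->
  1 <= `|(K^t* *m B *m L) i j| ->
  p 0 j * q 0 i <= (m * n)%:R ^+ 2 * (cp * cq) *
     \sum_a \sum_b `|B a b| ^+ 2 * (p 0 b * q 0 a).
Proof.
move=> /unitriu_tri hK /unitriu_tri hL K1 L1 p0 q0 hp hq hA.
have mn0 : 0 < (m * n)%:R :> C.
  by rewrite ltr0n muln_gt0 (leq_ltn_trans _ (ltn_ord i)) // (leq_ltn_trans _ (ltn_ord j)).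
have [/existsP [a /existsP [b /and3P[ai bj hB]]]|hN] :=
  boolP [exists a : 'I_m, exists b : 'I_n,
     [&& (a <= i)%N, (b <= j)%N & (m * n)%:R^-1 <= `|B a b|]].
  have hB2 : 1 <= (m * n)%:R ^+ 2 * `|B a b| ^+ 2.
    rewrite -exprMn; apply: exprn_ege1.
    by rewrite -(ler_pM2l (_ : 0 < (m * n)%:R^-1)) ?invr_gt0 // mulr1 mulKf ?gt_eqF.
  have hpq : p 0 j * q 0 i <= cp * cq * (p 0 b * q 0 a).
    rewrite mulrACA; apply: ler_pM; [exact: ltW|exact: ltW|exact: hp|exact: hq].
  have cpq : 0 <= cp * cq.
    rewrite -(pmulr_lge0 _ (mulr_gt0 (p0 b) (q0 a))).
    by apply: le_trans hpq; rewrite ltW // mulr_gt0.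
  have hle : `|B a b| ^+ 2 * (p 0 b * q 0 a) <=
      \sum_a \sum_b `|B a b| ^+ 2 * (p 0 b * q 0 a).
    rewrite (bigD1 a) //= (bigD1 b) //= -addrA lerDl addr_ge0 //.
      by apply: sumr_ge0 => c _; rewrite mulr_ge0 ?exprn_ge0 // ltW // mulr_gt0.
    apply: sumr_ge0 => d _; apply: sumr_ge0 => c _.
    by rewrite mulr_ge0 ?exprn_ge0 // ltW // mulr_gt0.
  apply: (@le_trans _ _ ((m * n)%:R ^+ 2 * (cp * cq) * (`|B a b| ^+ 2 * (p 0 b * q 0 a)))).
    rewrite (_ : _ * (cp * cq) * _ =
       ((m * n)%:R ^+ 2 * `|B a b| ^+ 2) * (cp * cq * (p 0 b * q 0 a))); last by ring.
    apply: (le_trans hpq); rewrite ler_peMl //.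
    by rewrite mulr_ge0 // ltW // mulr_gt0.
  by apply: ler_wpM2l => //; rewrite mulr_ge0 // exprn_ge0 // ltW.
suff : `|(K^t* *m B *m L) i j| < 1 by move/(le_lt_trans hA); rewrite ltxx.
have -> : 1 = \sum_(a < m) \sum_(b < n) (m * n)%:R^-1 :> C.
  by rewrite !sumr_const !card_ord -mulrnA -[RHS]mulr_natr [(n * m)%N]mulnC mulVf ?gt_eqF.
have -> : (K^t* *m B *m L) i j = \sum_(a < m) \sum_(b < n) (K a i)^* * B a b * L b j.
  rewrite mxE exchange_big /=; apply: eq_bigr => b _; rewrite mxE big_distrl /=.
  by apply: eq_bigr => a _; rewrite adjmxE.
have lt_ab a b : `|(K a i)^* * B a b * L b j| < (m * n)%:R^-1.
  have [ai|ia] := leqP a i; last by rewrite hK // conjC0 !mul0r normr0 invr_gt0.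
  have [bj|jb] := leqP b j; last by rewrite (hL b j) // mulr0 normr0 invr_gt0.
  have : `|B a b| < (m * n)%:R^-1.
    move: hN; rewrite negb_exists => /forallP /(_ a).
    rewrite negb_exists => /forallP /(_ b); rewrite ai bj /=.
    by rewrite real_ltNge // ?normr_real // rpredV realn.
  apply: le_lt_trans; rewrite !normrM norm_conjC -[leRHS]mul1r -[leRHS]mulr1.
  by apply: ler_pM; rewrite ?mulr_ge0 //; apply: ler_pM.
apply: le_lt_trans (ler_norm_sum _ _ _) _.
have hn : (0 < n)%N by apply: leq_ltn_trans (ltn_ord j).
have hm : (0 < m)%N by apply: leq_ltn_trans (ltn_ord i).
apply: ltr_sum => [|a _]; first by apply/hasP; exists i; rewrite ?mem_index_enum.
apply: le_lt_trans (ler_norm_sum _ _ _) _.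
by apply: ltr_sum => [|b _ //]; apply/hasP; exists j; rewrite ?mem_index_enum.
Qed.

End Gram.

(** * Coercivity under change of basis *)

Section Coercive.
Variable C : numClosedFieldType.

Lemma sqnorm_mulmx_le m n (N : 'M[C]_(m, n)) (w : 'cV[C]_n) :
  sqnorm (N *m w) <= (\sum_i (\sum_j `|N i j|) ^+ 2) * sqnorm w.
Proof.
have ws j : `|w j 0| <= sqrtC (sqnorm w).
  rewrite -(@ler_pXn2r _ 2) ?nnegrE ?sqrtC_ge0 ?sqnorm_ge0 // sqrtCK.
  by rewrite sqnormE (bigD1 j) //= lerDl sumr_ge0 //.
rewrite [sqnorm (_ *m _)]sqnormE big_distrl /=; apply: ler_sum => i _.
rewrite -[X in _ * X]sqrtCK -exprMn.
rewrite ler_pXn2r ?nnegrE ?mulr_ge0 ?sumr_ge0 ?sqrtC_ge0 ?sqnorm_ge0 //.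
rewrite mxE big_distrl /=; apply: le_trans (ler_norm_sum _ _ _) _.
by apply: ler_sum => j _; rewrite normrM ler_wpM2l.
Qed.

Lemma herm_congr m n (G : 'M[C]_(m, n)) (M : 'M[C]_m) :
  M^t* = M -> (G^t* *m M *m G)^t* = G^t* *m M *m G.
Proof. by move=> hM; rewrite !adjmxM trmxCK hM mulmxA. Qed.

(** Writing [v] as the inverse of [G] applied to [G *m v] bounds its squared norm by [k] times that
    of [G *m v]. Dividing by [1 + k] stays safe when [k] is 0. *)
Lemma coercive_congr n (G M : 'M[C]_n) eps :
  0 < eps -> coercive eps M -> G \in unitmx ->
  exists2 eps', 0 < eps' & coercive eps' (G^t* *m M *m G).
Proof.
move=> e0 cM uG; set k := \sum_i (\sum_j `|invmx G i j|) ^+ 2.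
have k0 : 0 <= k by apply: sumr_ge0 => i _; rewrite exprn_ge0 // sumr_ge0.
have k1 : 0 < 1 + k by rewrite ltr_pwDl.
exists (eps / (1 + k)) => [|v]; first by rewrite divr_gt0.
have -> : v^t* *m (G^t* *m M *m G) *m v = (G *m v)^t* *m M *m (G *m v).
  by rewrite adjmxM !mulmxA.
apply: le_trans (cM _); rewrite -mulrA ler_pM2l // mulrC ler_pdivrMr //.
rewrite -{1}[v](mulKmx uG); apply: le_trans (sqnorm_mulmx_le _ _) _.
by rewrite mulrC ler_wpM2l ?sqnorm_ge0 // -/k lerDr.
Qed.

Lemma coercive1 n : coercive 1 (1%:M : 'M[C]_n).
Proof. by move=> v; rewrite mul1r mulmx1. Qed.

Lemma quad_diag_entry n (T : 'M[C]_n) (d : 'rV[C]_n) j :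
  (T^t* *m diag_mx d *m T) j j = \sum_k `|T k j| ^+ 2 * d 0 k.
Proof.
rewrite mxE; apply: eq_bigr => k _.
by rewrite mul_mx_diag mxE adjmxE normCK; ring.
Qed.

Lemma quad_col_perm n (G M : 'M[C]_n) (s : 'S_n) j :
  ((col_perm s G)^t* *m M *m col_perm s G) j j = (G^t* *m M *m G) (s j) (s j).
Proof.
rewrite !mxE; apply: eq_bigr => k _; rewrite !mxE; congr (_ * _).
by apply: eq_bigr => l _; rewrite !mxE.
Qed.

Lemma norm_det_col_perm n (G : 'M[C]_n) (s : 'S_n) :
  `|\det (col_perm s G)| = `|\det G|.
Proof. by rewrite col_permE det_mulmx det_perm normrM normr_sign mulr1. Qed.

End Coercive.

(** * Gaussian integers and reduction of Hermitian forms on their lattices *)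

Section GaussianIntegers.
Variable R : realType.
Local Notation C := R[i].
Local Notation gint := (@gaussian_integer R).

Lemma gint0 : gint 0. Proof. by split; rewrite /= rpred0. Qed.

Lemma gint1 : gint 1. Proof. by split; rewrite /= ?rpred0 ?rpred1. Qed.

Lemma gintD x y : gint x -> gint y -> gint (x + y).
Proof. by case: x => a b; case: y => c d [/= ? ?] [/= ? ?]; split; rewrite /= rpredD. Qed.

Lemma gintN x : gint x -> gint (- x).
Proof. by case: x => a b [/= ? ?]; split; rewrite /= rpredN. Qed.

Lemma gintM x y : gint x -> gint y -> gint (x * y).
Proof.
by case: x => a b; case: y => c d [/= ? ?] [/= ? ?]; split;
  rewrite /= ?rpredB ?rpredD ?rpredM.
Qed.

Lemma gint_conj x : gint x -> gint x^*.
Proof. by case: x => a b [/= ? ?]; split; rewrite /= ?rpredN. Qed.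

Lemma gint_sum (I : finType) (F : I -> C) :
  (forall i, gint (F i)) -> gint (\sum_i F i).
Proof. by move=> h; apply: big_ind => //; [exact: gint0|exact: gintD]. Qed.

Lemma gint_prod (I : finType) (F : I -> C) :
  (forall i, gint (F i)) -> gint (\prod_i F i).
Proof. by move=> h; apply: big_ind => //; [exact: gint1|exact: gintM]. Qed.

Lemma gint_sign b : gint ((-1) ^+ (b : bool)).
Proof. by case: b; [apply: gintN|]; exact: gint1. Qed.

Lemma norm_gint_ge1 x : gint x -> x != 0 -> 1 <= `|x|.
Proof.
case: x => a b [/= ha hb] x0; rewrite -(@expr_ge1 _ 2) // -add_Re2_Im2 /=.
rewrite -[1](rmorph1 (real_complex R)) lecR.
have sq (c : R) : c \is a Num.int -> c != 0 -> 1 <= c ^+ 2.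
  by move=> hc c0; rewrite -real_normK ?num_real // exprn_ege1 // norm_intr_ge1.
have [a0|a0] := eqVneq a 0; last by rewrite ler_wpDr ?sqr_ge0 // sq.
rewrite ler_wpDl ?sqr_ge0 // sq //; apply: contraNneq x0 => b0.
by rewrite eq_complex /= a0 b0 !eqxx.
Qed.

(** Rounding the real and imaginary parts leaves an error of at most 1/2 in each, hence a squared
    modulus of at most 1/4 + 1/4. *)
Lemma gint_round (z : C) : exists2 u, gint u & 2 * `|z + u| ^+ 2 <= 1.
Proof.
case: z => a b; pose f (c : R) := (Num.floor (c + 2^-1))%:~R : R.
exists (Complex (- f a) (- f b)); first by split; rewrite /= rpredN intr_int.
have hf (c : R) : (c - f c) ^+ 2 <= 4^-1.
  have /andP[] := floor_itv (c + 2^-1); rewrite intrD -/(f c) => h1 h2.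
  by nra.
rewrite -add_Re2_Im2 /= -[2](rmorph_nat (real_complex R)) -rmorphM.
rewrite -[leRHS](rmorph1 (real_complex R)) lecR.
have := hf a; have := hf b; lra.
Qed.

Definition gmx m n (A : 'M[C]_(m, n)) := forall i j, gint (A i j).

Lemma gmxM m n p (A : 'M[C]_(m, n)) (B : 'M[C]_(n, p)) :
  gmx A -> gmx B -> gmx (A *m B).
Proof. by move=> hA hB i j; rewrite mxE; apply: gint_sum => k; apply: gintM. Qed.

Lemma gmx_adj m n (A : 'M[C]_(m, n)) : gmx A -> gmx (A^t*).
Proof. by move=> hA i j; rewrite adjmxE; apply: gint_conj. Qed.

Lemma gmx1 n : gmx (1%:M : 'M[C]_n).
Proof.
move=> i j; rewrite mxE; case: (i == j); [exact: gint1|exact: gint0].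
Qed.

Lemma gmx_det n (A : 'M[C]_n) : gmx A -> gint (\det A).
Proof.
move=> hA; apply: gint_sum => s; apply: gintM; first exact: gint_sign.
exact: gint_prod.
Qed.

(** A Gaussian integer of modulus 1 is a unit, so these are the invertible matrices over the
    Gaussian integers. *)
Definition unimodular n (G : 'M[C]_n) := gmx G /\ `|\det G| = 1.

Lemma unimodular1 n : unimodular (1%:M : 'M[C]_n).
Proof. by split; [exact: gmx1|rewrite det1 normr1]. Qed.

Lemma unimodular_unit n (G : 'M[C]_n) : unimodular G -> G \in unitmx.
Proof. by case=> _ h; rewrite unitmxE unitfE -normr_eq0 h oner_eq0. Qed.

Lemma sqnorm_col_ge1 n (G : 'M[C]_n) j : unimodular G -> 1 <= sqnorm (col j G).
Proof.
move=> hG; have [/existsP[i Gi]|] := boolP [exists i, G i j != 0].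
  rewrite sqnormE (bigD1 i) //= -[leLHS]addr0 lerD ?sumr_ge0 //.
  by rewrite mxE exprn_ege1 // norm_gint_ge1 //; apply hG.
rewrite negb_exists => /forallP h; case: hG => _ /eqP.
rewrite (expand_det_col _ j) big1 ?normr0 1?eq_sym ?oner_eq0 // => i _.
by have := h i; rewrite negbK => /eqP ->; rewrite mul0r.
Qed.

Lemma quad_col n (G M : 'M[C]_n) j :
  (G^t* *m M *m G) j j = ((col j G)^t* *m M *m col j G) 0 0.
Proof.
rewrite !mxE; apply: eq_bigr => k _; rewrite !mxE; congr (_ * _).
by apply: eq_bigr => l _; rewrite !mxE.
Qed.

(* The minimum is attained, but positivity of the infimum already gives a
   minimizer up to the factor 4/3, which is all the reduction needs. *)
Lemma near_shortest n (M : 'M[C]_n.+1) eps : 0 < eps -> coercive eps M ->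
  exists2 G0, unimodular G0 & forall G, unimodular G ->
    3 * (G0^t* *m M *m G0) 0 0 <= 4 * (G^t* *m M *m G) 0 0.
Proof.
(* Minimizing over whole bases rather than vectors makes the short vector come with a completion to
   a basis. *)
move=> e0 cM; pose q (G : 'M[C]_n.+1) := (G^t* *m M *m G) 0 0.
have qe G : unimodular G -> eps <= q G.
  move=> hG; rewrite /q quad_col; apply: le_trans (cM _).
  by rewrite ler_peMr ?(ltW e0) // sqnorm_col_ge1.
have qR G : unimodular G -> q G = (complex.Re (q G))%:C%C.
  by move=> hG; rewrite RRe_real // ger0_real // (le_trans _ (qe _ hG)) // ltW.
have eR : eps = (complex.Re eps)%:C%C by rewrite RRe_real // gtr0_real.
pose E := [set r : R | exists2 G, unimodular G & r = complex.Re (q G)]%classic.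
have Elb : lbound E (complex.Re eps).
  by move=> _ [G hG ->]; rewrite -lecR -qR // -eR qe.
have E0 : has_inf E.
  split; last by exists (complex.Re eps).
  by exists (complex.Re (q 1%:M)); exists 1%:M => //; exact: unimodular1.
have inf0 : 0 < inf E.
  apply: lt_le_trans (lb_le_inf E0.1 Elb).
  by rewrite -ltcR -eR.
(* A slack of one third of the positive infimum gives the factor 4/3. *)
have [_ [G0 hG0 ->] lt0] := inf_adherent (divr_gt0 inf0 (ltr0n R 3)) E0.
exists G0 => // G hG; rewrite -/(q G0) -/(q G) qR // (qR G) //.
rewrite -[3](rmorph_nat (real_complex R)) -[4](rmorph_nat (real_complex R)).
rewrite -!rmorphM lecR.
have : inf E <= complex.Re (q G) by apply: ge_inf; [exact: E0.2|exists G].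
by move: lt0; lra.
Qed.

(** Induction on the rank: take a nearly shortest first basis vector, reduce the Schur complement,
    then size-reduce the new first row. Comparing the first vector with the second gives
    [3 a <= 4 (|rho|^2 a + d1)] with [|rho|^2 <= 1/2], hence [a <= 4 d1]; chaining yields the powers
    of 4. *)
Lemma lattice_reduction n (M : 'M[C]_n) eps : 0 < eps -> M^t* = M -> coercive eps M ->
  exists (G T : 'M[C]_n) (d : 'rV[C]_n),
    [/\ unimodular G, unitriu T /\ (forall i j, `|T i j| <= 1),
        forall i, 0 < d 0 i,
        forall i j : 'I_n, (i <= j)%N -> d 0 i <= 4 ^+ (j - i) * d 0 j &
        G^t* *m M *m G = T^t* *m diag_mx d *m T].
Proof.
elim: n M eps => [|n IH] M eps e0 hM cM.
  exists 1%:M, 1%:M, 0; split=> [|||[]//|]; try by case.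
  - exact: unimodular1.
  - by split => -[].
  - by apply/matrixP => -[].
have [G0 hG0 minG0] := near_shortest e0 cM.
pose M0 := G0^t* *m M *m G0.
have hM0 : M0^t* = M0 by apply: herm_congr.
have [e1 e10 cM0] := coercive_congr e0 cM (unimodular_unit hG0).
have [r [S [hS cS ea eqM0]]] := @schur_complement C n M0 e1 e10 hM0 cM0.
have [G1 [T1 [d1 [hG1 [hT1 T1le] d10 d1le eqS]]]] := IH S e1 e10 hS cS.
have a0 : 0 < M0 0 0 by apply: lt_le_trans ea.
set a := M0 0 0 in ea a0 eqM0.
(* Size reduction: adding integral multiples of the first basis vector to the others shrinks the row
   and keeps the pivots. *)
have /choice [u hu] j : exists v, gint v /\ 2 * `|(r *m G1) 0 j + v| ^+ 2 <= 1.
  by have [v hv1 hv2] := gint_round ((r *m G1) 0 j); exists v.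
pose ur : 'rV[C]_n := \row_j u j; pose rho := r *m G1 + ur.
have rho2 j : 2 * `|rho 0 j| ^+ 2 <= 1 by rewrite /rho !mxE; have [_] := hu j; rewrite mxE.
pose Q : 'M[C]_(1 + n) := block_mx 1%:M ur 0 G1.
pose T : 'M[C]_(1 + n) := block_mx 1%:M rho 0 T1.
pose d : 'rV[C]_(1 + n) := row_mx a%:M d1.
have hT : unitriu T by apply: unitriu_block.
have gQ : gmx Q.
  move=> i j; case: (split_ordP i) => i' ->; case: (split_ordP j) => j' ->.
  - by rewrite block_mxEul; apply: gmx1.
  - by rewrite block_mxEur mxE; have [] := hu j'.
  - by rewrite block_mxEdl mxE; apply: gint0.
  - by rewrite block_mxEdr; apply hG1.1.
have detQ : `|\det Q| = 1 by rewrite det_ublock det1 mul1r hG1.2.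
have hG : unimodular (G0 *m Q).
  split; first exact: gmxM hG0.1 gQ.
  by rewrite det_mulmx normrM hG0.2 detQ mulr1.
have Tle i j : `|T i j| <= 1.
  case: (split_ordP i) => i' ->; case: (split_ordP j) => j' ->.
  - by rewrite block_mxEul !ord1 mxE eqxx normr1.
  - rewrite block_mxEur -(@expr_le1 _ 2) // ord1.
    apply: le_trans (rho2 j'); rewrite mulr_natl mulr2n lerDl.
    by rewrite exprn_ge0.
  - by rewrite block_mxEdl mxE normr0.
  - by rewrite block_mxEdr.
have eqG : (G0 *m Q)^t* *m M *m (G0 *m Q) = T^t* *m diag_mx d *m T.
  rewrite adjmxM -!mulmxA (mulmxA M) (mulmxA (G0^t*)) (mulmxA (G0^t*)) -/M0 eqM0.
  have WQ : (block_mx 1%:M r 0 1%:M : 'M[C]_(1 + n)) *m Q = block_mx 1%:M rho 0 G1.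
    rewrite mulmx_block !(mul1mx, mul0mx, mulmx0, mulmx1, addr0, add0r).
    by rewrite addrC.
  rewrite -!mulmxA WQ (mulmxA (Q^t*)) -adjmxM WQ.
  rewrite diag_mx_row diag_mx11 !adj_block !adjmx1 trmx0 map_mx0.
  rewrite !mulmx_block !(mul1mx, mul0mx, mulmx0, mulmx1, addr0, add0r).
  by rewrite !mulmxA eqS.
exists (G0 *m Q), T, d; split=> //.
- move=> i; case: (@split_ordP 1 n i) => j ->.
    by rewrite (@row_mxEl _ 1 1 n) ord1 mxE eqxx mulr1n.
  by rewrite (@row_mxEr _ 1 1 n).
move=> i j; case: (@split_ordP 1 n i) => i' ->; case: (@split_ordP 1 n j) => j' ->.
- by rewrite !(@row_mxEl _ 1 1 n) !ord1 subnn expr0 mul1r.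
- move=> _; rewrite (@row_mxEl _ 1 1 n) (@row_mxEr _ 1 1 n) !ord1 mxE eqxx mulr1n /= subn0.
  have n0 : (0 < n)%N by apply: leq_ltn_trans (ltn_ord j').
  pose o : 'I_n := Ordinal n0.
  have := d1le o j' (leq0n _); rewrite subn0 exprS -mulrA => h1.
  suff : a <= 4 * d1 0 o by move=> /le_trans; apply; rewrite ler_pM2l // ltr0n.
  (* Swapping the first two basis vectors makes the second one a competitor in the near-minimality
     of [G0]. *)
  pose G' := col_perm (tperm 0 (rshift 1 o)) (G0 *m Q).
  have hG' : unimodular G'.
    by split; [move=> k l; rewrite mxE; apply hG.1|rewrite norm_det_col_perm hG.2].
  have Tcol : \sum_k `|T k (rshift 1 o)| ^+ 2 * d 0 k = `|rho 0 o| ^+ 2 * a + d1 0 o.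
    rewrite big_split_ord /= big_ord1 block_mxEur row_mxEl [a%:M _ _]mxE eqxx mulr1n.
    rewrite (bigD1 o) //= big1 => [|k /negPf ko]; last first.
      by rewrite block_mxEdr hT1 // ko normr0 expr0n mul0r.
    by rewrite block_mxEdr row_mxEr hT1 // eqxx normr1 expr1n mul1r addr0.
  have := minG0 G' hG'; rewrite -/M0 -/a quad_col_perm tpermL eqG quad_diag_entry.
  rewrite Tcol.
  rewrite mulrDr (_ : 3 = 1 + 2) // mulrDl mul1r => /le_trans h.
  rewrite -(lerD2r (2 * a)); apply: h; rewrite addrC lerD2l.
  rewrite (_ : 4 = 2 * 2); last by rewrite -natrM.
  by rewrite -mulrA ler_pM2l // mulrA -[leRHS]mul1r ler_pM2r //.
- by rewrite [j']ord1.
- rewrite !(@row_mxEr _ 1 1 n) /= leq_add2l subnDl; exact: d1le.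
Qed.

End GaussianIntegers.

(** * Majorization and projection to the monotone cone *)

Section Majorization.
Variable R : realType.
Implicit Types (a u v w x s : nat -> R).

(** Abel summation: the difference of the two sides combines partial sums of [w] with the
    nonnegative coefficients [a i - a i.+1]. *)
Lemma abel_ge0 n a w :
  (forall i j, (i <= j)%N -> (j <= n)%N -> a j <= a i) ->
  (forall t, (t <= n.+1)%N -> 0 <= \sum_(i < t) w i) ->
  a n * \sum_(i < n.+1) w i <= \sum_(i < n.+1) a i * w i.
Proof.
elim: n => [|n IH] ha hw; first by rewrite !big_ord1.
rewrite big_ord_recr [leRHS]big_ord_recr /= mulrDr lerD2r.
apply: (@le_trans _ _ (a n * \sum_(i < n.+1) w i)).
  by apply: ler_wpM2r; [exact: hw|exact: ha].
by apply: IH => [i j ij jn|t tn]; [apply: ha|apply: hw] => //; exact: leqW.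
Qed.

(** Abel summation for [v - u]. Equal totals cancel the boundary term, so [a] may have any sign. *)
Lemma majorization_le n a u v :
  (forall i j, (i <= j)%N -> (j < n)%N -> a j <= a i) ->
  (forall t, (t <= n)%N -> \sum_(i < t) u i <= \sum_(i < t) v i) ->
  \sum_(i < n) u i = \sum_(i < n) v i ->
  \sum_(i < n) a i * u i <= \sum_(i < n) a i * v i.
Proof.
case: n => [|n] ha huv eq_uv; first by rewrite !big_ord0.
have := @abel_ge0 n a (fun i => v i - u i) ha.
rewrite [X in _ <= X](eq_bigr (fun i : 'I_n.+1 => a i * v i - a i * u i)) => [|i _].
  rewrite !sumrB eq_uv subrr mulr0 subr_ge0; apply=> t tn.
  by rewrite sumrB subr_ge0 huv.
by rewrite mulrBr.
Qed.

(** The largest nonincreasing sequence below [x]. *)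
Fixpoint running_min x i : R :=
  if i is j.+1 then Num.min (running_min x j) (x i) else x 0.

Lemma running_min_le x i : running_min x i <= x i.
Proof. by case: i => [|i] //=; rewrite ge_min lexx orbT. Qed.

Lemma running_min_noninc x i j : (i <= j)%N -> running_min x j <= running_min x i.
Proof.
elim: j => [|j IH]; first by rewrite leqn0 => /eqP ->.
rewrite leq_eqVlt => /orP[/eqP -> //|]; rewrite ltnS => /IH; apply: le_trans.
by rewrite /= ge_min lexx.
Qed.

Lemma running_min_ex x i : exists2 j, (j <= i)%N & running_min x i = x j.
Proof.
elim: i => [|i [j ji eqj]]; first by exists 0.
rewrite /=; have [le_|lt_] := leP (running_min x i) (x i.+1).
  by exists j => //; exact: leqW.
by exists i.+1.
Qed.

(** The indices with [m i >= th] form an initial segment, on which the maximum is [m i]; each later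
    term equals [th], which is at most [s i]. *)
Lemma prefix_max_le n (m s : nat -> R) (th : R) t :
  (forall i j, (i <= j)%N -> m j <= m i) ->
  (forall i, (i < n)%N -> m i < th -> th <= s i) ->
  (forall t, (t <= n)%N -> \sum_(i < t) m i <= \sum_(i < t) s i) ->
  (t <= n)%N -> \sum_(i < t) Num.max (m i) th <= \sum_(i < t) s i.
Proof.
move=> hm hs hms; elim: t => [|t IH] tn; first by rewrite !big_ord0.
have [tm|mt] := leP th (m t).
  rewrite (eq_bigr (fun i : 'I_t.+1 => m i)) ?hms // => i _.
  by apply/max_idPl; rewrite (le_trans tm) // hm // -ltnS.
rewrite !big_ord_recr /= lerD ?IH ?(ltnW tn) //.
by rewrite (max_idPr (ltW mt)) hs.
Qed.

(* Raising the running minimum of [x] to a water level [th] keeps it below [s]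
   in the majorization order; [th] is tuned so that no mass is lost. *)
Lemma water_filling n x s (c : R) : (0 < n)%N ->
  (forall i j, (i <= j)%N -> (j < n)%N -> s j <= s i) ->
  (forall i, (i < n)%N -> 0 <= s i) ->
  (forall t, (t <= n)%N -> \sum_(i < t) x i <= \sum_(i < t) s i) ->
  \sum_(i < n) x i = \sum_(i < n) s i ->
  (forall i j, (i <= j)%N -> (j < n)%N -> x j <= x i + c) ->
  exists y : nat -> R,
    [/\ forall i j, (i <= j)%N -> y j <= y i,
        forall i, 0 <= y i,
        forall t, (t <= n)%N -> \sum_(i < t) y i <= \sum_(i < t) s i,
        \sum_(i < n) y i = \sum_(i < n) s i &
        forall i, (i < n)%N -> x i <= y i + c].
Proof.
move=> n0 hs s0 hxs eq_xs hx; pose m := running_min x.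
have mm := @running_min_noninc x.
have hms t : (t <= n)%N -> \sum_(i < t) m i <= \sum_(i < t) s i.
  move=> tn; apply: le_trans (hxs t tn).
  by apply: ler_sum => i _; exact: running_min_le.
pose g (th : R) := \sum_(i < n) Num.max (m i) th.
have S0 : 0 <= \sum_(i < n) s i by apply: sumr_ge0 => i _; exact: s0.
have g0 : g 0 <= \sum_(i < n) s i.
  by apply: (@prefix_max_le n) => // i ni _; exact: s0.
have g1 : \sum_(i < n) s i <= g (\sum_(i < n) s i).
  rewrite /g [leRHS](bigD1 (Ordinal n0)) //= -[leLHS]addr0 lerD //.
    by rewrite le_max lexx orbT.
  by apply: sumr_ge0 => i _; rewrite le_max S0 orbT.
(* The mass [g] depends continuously on the water level and passes the total of [s] between the
   levels 0 and that total. *)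
have cg : continuous g.
  apply: continuous_big => [|i _ th]; first exact: add_continuous.
  by apply: (@continuous_max _ _ (fun=> m i) id th); [exact: cvg_cst|exact: cvg_id].
have [th /[!in_itv]/= /andP[th0 _] gth] : exists2 th,
    th \in `[0, \sum_(i < n) s i] & g th = \sum_(i < n) s i.
  apply: IVT => //; first exact: continuous_subspaceT.
  by rewrite ge_min g0 le_max g1 orbT.
exists (fun i => Num.max (m i) th); split=> //.
- by move=> i j ij; rewrite ge_max !le_max lexx mm //= orbT.
- by move=> i; rewrite le_max th0 orbT.
- move=> t; elim: t => [|t IH] tn; first by rewrite !big_ord0.
  have [tm|mt] := leP th (m t).
    rewrite (eq_bigr (fun i : 'I_t.+1 => m i)) ?hms // => i _.
    by apply/max_idPl; rewrite (le_trans tm) // mm // -ltnS.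
  have [ts|st] := leP th (s t).
    by rewrite !big_ord_recr /= lerD ?IH ?(ltnW tn) // (max_idPr (ltW mt)).
  (* Here [s] has dropped below the level [th] and stays below, so the raised sequence has the
     larger tail; equal totals then give it the smaller prefix. *)
  have split_sum (f : nat -> R) :
      \sum_(i < n) f i = \sum_(i < t.+1) f i + \sum_(t.+1 <= i < n) f i.
    by rewrite -!(big_mkord xpredT f) (big_cat_nat (leq0n t.+1) tn).
  have := gth; rewrite /g (split_sum (fun i => Num.max (m i) th)) (split_sum s).
  suff : \sum_(t.+1 <= i < n) s i <= \sum_(t.+1 <= i < n) Num.max (m i) th by lra.
  rewrite !big_nat; apply: ler_sum => i /andP[ti ni].
  rewrite le_max (le_trans _ (ltW st)) ?orbT // hs // ltnW //.
- move=> i ni; have [j ji eqj] := running_min_ex x i.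
  by rewrite (le_trans (hx j i ji ni)) // lerD2r /m eqj le_max lexx.
Qed.

(** Subtract the value of [s] at the first tail index: tail entries become nonpositive and all
    others nonnegative. Both index sets have [k] elements, so the shift cancels. *)
Lemma sum_smallest_le n s k (f : 'I_k -> 'I_n) :
  (forall i j, (i <= j)%N -> (j < n)%N -> s j <= s i) -> injective f ->
  \sum_(i < n | (n - k <= i)%N) s i <= \sum_(r < k) s (f r).
Proof.
move=> hs inj_f.
have kn : (k <= n)%N by have := leq_card f inj_f; rewrite !card_ord.
case: k => [|k] in f inj_f kn *.
  by rewrite big_ord0 big_pred0 // => i; rewrite subn0 leqNgt ltn_ord.
pose th := s (n - k.+1)%N.
pose I := [set f r | r : 'I_k.+1]; pose J := [set i : 'I_n | (n - k.+1 <= i)%N].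
have cI : #|I| = k.+1 by rewrite card_imset // card_ord.
have cJ : #|J| = k.+1.
  have -> : J = [set rev_ord (widen_ord kn r) | r : 'I_k.+1].
    apply/setP => i; rewrite inE; apply/idP/imsetP => [ni|[r _ ->]] /=; last first.
      by have := ltn_ord r; lia.
    have ik : (n - i.+1 < k.+1)%N by have := ltn_ord i; lia.
    exists (Ordinal ik) => //; apply: val_inj => /=; have := ltn_ord i; lia.
  rewrite card_imset ?card_ord // => a b /rev_ord_inj /(congr1 val) /= ab.
  exact: val_inj.
have -> : \sum_(r < k.+1) s (f r) = \sum_(i in I) s i.
  by rewrite big_imset //= => a b _ _; apply: inj_f.
rewrite (eq_bigl [in J]) => [|i]; last by rewrite inE.
suff : \sum_(i in J) (s i - th) <= \sum_(i in I) (s i - th).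
  by rewrite !sumrB !sumr_const cI cJ lerD2r.
rewrite [leLHS]big_mkcond [leRHS]big_mkcond; apply: ler_sum => i _.
rewrite [in leLHS]inE; have [ni|ni] := leqP (n - k.+1) i.
  by case: ifP => // _; rewrite subr_le0 hs.
case: ifP => // _; rewrite subr_ge0 hs ?(ltnW ni) //.
by rewrite -subSn // leq_subLR; lia.
Qed.

End Majorization.

(** * Unitary diagonalization and uniqueness of the spectrum *)

Local Open Scope complex_scope.

Lemma char_poly_conj (F : fieldType) n (P D : 'M[F]_n) : P \in unitmx ->
  char_poly (invmx P *m D *m P) = char_poly D.
Proof.
move=> uP; rewrite /char_poly /char_poly_mx.
have -> : 'X%:M - map_mx polyC (invmx P *m D *m P) =
  map_mx polyC (invmx P) *m ('X%:M - map_mx polyC D) *m map_mx polyC P.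
  rewrite mulmxBr mulmxBl mul_mx_scalar -scalemxAl -!map_mxM mulVmx //.
  by rewrite map_mx1 scalemx1.
by rewrite !det_mulmx mulrAC -det_mulmx -map_mxM mulVmx // map_mx1 det1 mul1r.
Qed.

(** Both diagonals list the roots of the same characteristic polynomial. *)
Lemma diag_conj_perm (F : fieldType) n (P Q : 'M[F]_n) (d e : 'rV[F]_n) :
  P \in unitmx -> Q \in unitmx ->
  invmx P *m diag_mx d *m P = invmx Q *m diag_mx e *m Q ->
  perm_eq [seq d 0 i | i : 'I_n] [seq e 0 i | i : 'I_n].
Proof.
move=> uP uQ /(congr1 char_poly); rewrite !char_poly_conj //.
rewrite !char_poly_trig ?diag_mx_is_trig // => de.
apply: prod_XsubC_eq; rewrite !big_image /=.
have dE (c : 'rV[F]_n) : \prod_i ('X - (c 0 i)%:P) = \prod_i ('X - (diag_mx c i i)%:P).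
  by apply: eq_bigr => i _; rewrite mxE eqxx.
by rewrite !dE.
Qed.

Lemma map_image_comp (T : finType) (A B : Type) (g : A -> B) (f : T -> A) :
  map g [seq f i | i : T] = [seq g (f i) | i : T].
Proof. by rewrite /image_mem -map_comp. Qed.

Lemma eq_image_fun (T : finType) (A : Type) (f g : T -> A) :
  f =1 g -> [seq f i | i : T] = [seq g i | i : T].
Proof. by move=> fg; apply: eq_map. Qed.

Section UnitarySpectral.
Variable C : numClosedFieldType.

Lemma unitary_adjK n (U : 'M[C]_n) : U \is unitarymx -> U^t* *m U = 1%:M.
Proof. by move/unitarymxP/mulmx1C. Qed.

Lemma unitary_spectral n (U : 'M[C]_n) (d : 'rV[C]_n) :
  U \is unitarymx -> let H := U *m diag_mx d *m U^t* in
  H = invmx (spectralmx H) *m diag_mx (spectral_diag H) *m spectralmx H /\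
  perm_eq [seq spectral_diag H 0 i | i : 'I_n] [seq d 0 i | i : 'I_n].
Proof.
move=> uU H; have uV : U^t* \is unitarymx by rewrite trmxC_unitary.
have HE : H = invmx (U^t*) *m diag_mx d *m U^t* by rewrite invmx_unitary // trmxCK.
have nH : H \is normalmx.
  by apply/orthomx_spectral_subproof; exists (U^t*, d).
have spE : H = invmx (spectralmx H) *m diag_mx (spectral_diag H) *m spectralmx H.
  exact/orthomx_spectralP.
split=> //.
apply: (@diag_conj_perm _ _ (spectralmx H) (U^t*)); rewrite ?spectral_unit //.
  exact: unitarymx_unit.
by rewrite -spE HE.
Qed.

Lemma col_perm_diag n (V : 'M[C]_n) (p : 'S_n) (d : 'rV[C]_n) :
  col_perm p V *m diag_mx (\row_i d 0 (p i)) *m (col_perm p V)^t* =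
  V *m diag_mx d *m V^t*.
Proof.
apply/matrixP => i k; rewrite !mul_mx_diag !mxE [RHS](reindex_inj (@perm_inj _ p)) /=.
by apply: eq_bigr => j _; rewrite !mxE.
Qed.

Lemma col_perm_unitary n (V : 'M[C]_n) (p : 'S_n) :
  V \is unitarymx -> col_perm p V \is unitarymx.
Proof.
move=> /unitarymxP hV; apply/unitarymxP.
have := col_perm_diag V p (const_mx 1).
rewrite (_ : \row_i _ = const_mx 1); last by apply/rowP => i; rewrite !mxE.
by rewrite diag_const_mx !mulmx1 hV.
Qed.

Lemma herm_quad_diag n (P : 'M[C]_n) (d : 'rV[C]_n) i (v : 'cV[C]_n) :
  P \is unitarymx -> v = P^t* *m delta_mx i 0 ->
  (v^t* *m (P^t* *m diag_mx d *m P) *m v) 0 0 = d 0 i.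
Proof.
move=> /unitarymxP hP ->.
rewrite adjmxM trmxCK !mulmxA.
rewrite -(mulmxA _ P (P^t*)) hP mulmx1 -(mulmxA _ P (P^t*)) hP mulmx1.
rewrite trmx_delta map_delta_mx -mulmxA -rowE mul_diag_mx mxE mxE.
by rewrite !mxE !eqxx mulr1.
Qed.

Lemma herm_spectralE n (X : 'M[C]_n) : X \is hermsymmx ->
  X = (spectralmx X)^t* *m diag_mx (spectral_diag X) *m spectralmx X.
Proof.
move=> hX; rewrite -invmx_unitary ?spectral_unitarymx //.
exact/orthomx_spectralP/hermitian_normalmx.
Qed.

Lemma spectral_diag_ge1 n (X : 'M[C]_n) i : X \is hermsymmx ->
  (forall v : 'cV[C]_n, 0 <= (v^t* *m (X - 1%:M) *m v) 0 0) ->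
  1 <= spectral_diag X 0 i.
Proof.
move=> hX X1; have uP := spectral_unitarymx X.
pose v : 'cV[C]_n := (spectralmx X)^t* *m delta_mx i 0.
have := X1 v; rewrite mulmxBr mulmxBl mxE [X in _ + X]mxE subr_ge0.
have vq d := herm_quad_diag d uP (erefl v).
rewrite [Z in _ <= (_ *m Z *m _) _ _](herm_spectralE hX) vq.
have e1 := vq (const_mx 1).
by rewrite diag_const_mx mulmx1 unitary_adjK // [RHS]mxE in e1; rewrite e1.
Qed.

Lemma diag_conj_herm n (U : 'M[C]_n) (d : 'rV[C]_n) : (forall i, 0 <= d 0 i) ->
  (U *m diag_mx d *m U^t*)^t* = U *m diag_mx d *m U^t*.
Proof.
move=> d0; rewrite !adjmxM trmxCK mulmxA tr_diag_mx map_diag_mx.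
congr (_ *m diag_mx _ *m _); apply/rowP => i; rewrite !mxE.
by apply/CrealP; rewrite ger0_real.
Qed.

Lemma diag_conj_sub1 n (U : 'M[C]_n) (d : 'rV[C]_n) : U \is unitarymx ->
  U *m diag_mx d *m U^t* - 1%:M = U *m diag_mx (d - const_mx 1) *m U^t*.
Proof.
move=> /unitarymxP uU.
by rewrite linearB /= mulmxBr mulmxBl diag_const_mx mulmx1 uU.
Qed.

Lemma diag_conj_psd n (U : 'M[C]_n) (d : 'rV[C]_n) (v : 'cV[C]_n) :
  (forall i, 0 <= d 0 i) -> 0 <= (v^t* *m (U *m diag_mx d *m U^t*) *m v) 0 0.
Proof.
move=> d0; have -> : v^t* *m (U *m diag_mx d *m U^t*) *m v =
    (U^t* *m v)^t* *m diag_mx d *m (U^t* *m v) by rewrite adjmxM trmxCK !mulmxA.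
rewrite mxE; apply: sumr_ge0 => k _; rewrite mul_mx_diag mxE adjmxE mulrAC.
by apply: mulr_ge0; rewrite // mulrC mul_conjC_ge0.
Qed.

End UnitarySpectral.

(** * Exponential coordinates on positive definite matrices *)

Section Spectral.
Variable R : realType.
Local Notation C := R[i].

(** [U] is left arbitrary: besides unitary frames, the reduced bases [G *m invmx T] are used in this
    form. *)
Definition exp_conj n (U : 'M[C]_n) (x : 'I_n -> R) : 'M[C]_n :=
  U *m diag_mx (\row_i (expR (x i))%:C) *m U^t*.

Lemma sorted_ge_nonincreasing n (y : 'rV[R]_n) : nonincreasing_vec y ->
  sorted >=%R [seq y 0 i | i : 'I_n].
Proof.
move=> hy; rewrite sorted_map.
have : sorted (relpre val leq) (enum 'I_n).
  by rewrite -sorted_map val_enum_ord iota_sorted.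
by apply: sub_sorted => i j /=; apply: hy.
Qed.

Lemma eigvals_conj n (U : 'M[C]_n) (x : 'I_n -> R) (y : 'rV[R]_n) :
  U \is unitarymx -> nonincreasing_vec y ->
  perm_eq [seq x i | i : 'I_n] [seq y 0 i | i : 'I_n] ->
  eigvals (U *m diag_mx (\row_i (x i)%:C) *m U^t*) = y.
Proof.
move=> uU hy pxy; set H := _ *m _ *m _.
have [_ pH] := unitary_spectral (\row_i (x i)%:C) uU; rewrite -/H in pH.
have pR : perm_eq [seq complex.Re (spectral_diag H 0 i) | i : 'I_n] [seq y 0 i | i : 'I_n].
  apply: perm_trans pxy; have := perm_map (@complex.Re R) pH.
  rewrite !map_image_comp => /perm_trans; apply.
  by rewrite (eq_image_fun (g := x)) // => i; rewrite mxE.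
have sE : sort >=%R [seq complex.Re (spectral_diag H 0 i) | i : 'I_n] =
          [seq y 0 i | i : 'I_n].
  rewrite -[RHS](sorted_sort ge_trans (sorted_ge_nonincreasing hy)).
  by apply/perm_sortP => //; [exact: ge_total|exact: ge_trans|exact: ge_anti].
apply/rowP => i; rewrite mxE sE (nth_map i) ?size_enum_ord // nth_ord_enum //.
Qed.

(** [logmx] uses its own spectral basis instead of [U], so eigenvalues are compared as multisets and
    then sorted. *)
Lemma eigvals_log_exp_conj n (U : 'M[C]_n) (x : 'I_n -> R) (y : 'rV[R]_n) :
  U \is unitarymx -> nonincreasing_vec y ->
  perm_eq [seq x i | i : 'I_n] [seq y 0 i | i : 'I_n] ->
  eigvals (logmx (exp_conj U x)) = y.
Proof.
move=> uU hy pxy; set X := exp_conj U x.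
have [_ pX] := unitary_spectral (\row_i (expR (x i))%:C) uU; rewrite -/X in pX.
have uP := spectral_unitarymx X.
have uP' : (spectralmx X)^t* \is unitarymx by rewrite trmxC_unitary.
rewrite /logmx invmx_unitary //.
have := @eigvals_conj _ _ (fun i => ln (complex.Re (spectral_diag X 0 i))) y uP' hy.
rewrite trmxCK; apply.
apply: perm_trans pxy; have := perm_map (fun c => ln (@complex.Re R c)) pX.
rewrite !map_image_comp => /perm_trans; apply.
by rewrite (eq_image_fun (g := x)) // => i; rewrite mxE /= expRK.
Qed.

Lemma spectral_decomposition n (X : 'M[C]_n) :
  X \is hermsymmx -> loewner_le 1%:M X ->
  exists2 U : 'M[C]_n, U \is unitarymx &
    [/\ X = exp_conj U (fun i => eigvals (logmx X) 0 i),
        nonincreasing_vec (eigvals (logmx X)) &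
        forall i, 0 <= eigvals (logmx X) 0 i].
Proof.
move=> hX [_ X1]; set P := spectralmx X; set sp := spectral_diag X.
have uP : P \is unitarymx by apply: spectral_unitarymx.
have XE : X = P^t* *m diag_mx sp *m P by apply: herm_spectralE.
have sp1 i : 1 <= sp 0 i by apply: spectral_diag_ge1.
pose l i := ln (complex.Re (sp 0 i)).
have spE i : sp 0 i = (expR (l i))%:C.
  have spR : sp 0 i = (complex.Re (sp 0 i))%:C.
    by rewrite RRe_real // ger0_real // (le_trans ler01).
  rewrite {1}spR lnK // posrE (lt_le_trans ltr01) //.
  by rewrite -lecR -spR rmorph1.
have l0 i : 0 <= l i.
  rewrite ln_ge0 // -lecR rmorph1 RRe_real // ger0_real // (le_trans ler01) //.
pose s := sort >=%R [seq l i | i : 'I_n].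
have /tuple_permP [p sE] : perm_eq s [tuple l i | i < n].
  by rewrite perm_sort.
pose y : 'rV[R]_n := \row_i l (p i).
have sy : s = [seq y 0 i | i : 'I_n].
  by rewrite sE /=; apply: eq_image_fun => i; rewrite tnth_mktuple mxE.
have hy : nonincreasing_vec y.
  move=> i j ij; have := sort_sorted (@ge_total _ R) [seq l i | i : 'I_n].
  rewrite -/s sy => /(sorted_leq_nth ge_trans ge_refl 0) /(_ i j).
  rewrite !inE size_map size_enum_ord !ltn_ord => /(_ isT isT ij).
  have nthy (k : 'I_n) : nth 0 [seq y 0 i | i : 'I_n] k = y 0 k.
    by rewrite (nth_map k) ?size_enum_ord // nth_ord_enum.
  by rewrite !nthy.
pose U := col_perm p (P^t*).
have uU : U \is unitarymx by apply: col_perm_unitary; rewrite trmxC_unitary.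
have XU : X = exp_conj U (fun i => y 0 i).
  have XE' : X = P^t* *m diag_mx sp *m (P^t*)^t* by rewrite trmxCK -XE.
  rewrite {1}XE' -(col_perm_diag (P^t*) p sp) /exp_conj.
  by congr (_ *m diag_mx _ *m _); apply/rowP => i; rewrite !mxE spE.
have ey : eigvals (logmx X) = y by rewrite XU; apply: eigvals_log_exp_conj.
exists U => //; rewrite ey; split=> // i; rewrite mxE; exact: l0.
Qed.

Lemma inv_exp_conj n (U : 'M[C]_n) (x : 'I_n -> R) : U \is unitarymx ->
  invmx (exp_conj U x) = exp_conj U (fun i => - x i).
Proof.
move=> uU; have uUv := unitary_adjK uU; have/unitarymxP uU1 := uU.
have e : exp_conj U x *m exp_conj U (fun i => - x i) = 1%:M.
  rewrite /exp_conj !mulmxA -(mulmxA _ (U^t*) U) uUv mulmx1 -(mulmxA U) mulmx_diag.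
  rewrite (_ : \row_i _ = const_mx 1) ?diag_const_mx ?mulmx1 //.
  by apply/rowP => i; rewrite !mxE -rmorphM /= expRN mulfV ?gt_eqF ?expR_gt0.
have [u1 _] := mulmx1_unit e.
by rewrite -[RHS]mul1mx -(mulVmx u1) -mulmxA e mulmx1.
Qed.

Lemma exp_conj_dom n (U : 'M[C]_n) (x : 'I_n -> R) : U \is unitarymx ->
  (forall i, 0 <= x i) ->
  exp_conj U x \is hermsymmx /\ loewner_le 1%:M (exp_conj U x).
Proof.
move=> uU x0; pose d : 'rV[C]_n := \row_i (expR (x i))%:C.
have d1 i : 0 <= (d - const_mx 1) 0 i.
  by rewrite !mxE subr_ge0 -(rmorph1 (real_complex R)) lecR -[leLHS]expR0 ler_expR.
have d0 i : 0 <= d 0 i by rewrite mxE ler0c expR_ge0.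
split; first exact/hermP/diag_conj_herm.
split=> [|v]; rewrite diag_conj_sub1 //; first exact/hermP/diag_conj_herm.
exact: diag_conj_psd.
Qed.

End Spectral.

(** * Triangular matrices, flags and supports *)

Section Triangular.
Variable C : numClosedFieldType.

(** Back substitution, from the last row upwards. *)
Lemma unitriu_inv_tri n (T S : 'M[C]_n) : unitriu T -> T *m S = 1%:M -> trimx S.
Proof.
move=> hT TS i j; have [k] := ubnP (n - i)%N.
elim: k i => // k IH i ik ji; have /matrixP /(_ i j) := TS.
rewrite !mxE (bigD1 i) //= hT // eqxx mul1r big1 => [|l li].
  by rewrite addr0 => ->; case: eqVneq ji => // ->; rewrite ltnn.
have [lti|il] := ltnP l i; first by rewrite (unitriu_tri hT) // mul0r.
have {}il : (i < l)%N by rewrite ltn_neqAle il andbT eq_sym.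
by rewrite IH ?mulr0 ?(ltn_trans ji) //; have := ltn_ord l; lia.
Qed.

(** The QR factorization, obtained by factoring the Gram matrix of [G]: [K] is the inverse of [T]
    scaled by inverse square roots of the pivots. *)
Lemma unitary_triangular n (G : 'M[C]_n) : G \in unitmx ->
  exists2 K, trimx K & G *m K \is unitarymx.
Proof.
move=> uG.
have [e e0 cG] := coercive_congr ltr01 (@coercive1 C n) uG.
have hG : (G^t* *m 1%:M *m G)^t* = G^t* *m 1%:M *m G by apply/herm_congr/adjmx1.
have [T [d [hT d0 GE]]] := ldl_exists e0 hG cG; rewrite mulmx1 in GE.
pose c : 'rV[C]_n := \row_i (sqrtC (d 0 i))^-1.
have cJ : (diag_mx c)^t* = diag_mx c.
  rewrite tr_diag_mx map_diag_mx; congr diag_mx; apply/rowP => i; rewrite !mxE.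
  by apply/CrealP; rewrite ger0_real // invr_ge0 sqrtC_ge0 ltW.
have uT := unitriu_unit hT.
exists (invmx T *m diag_mx c).
  move=> i j ji; rewrite mul_mx_diag mxE.
  by rewrite (unitriu_inv_tri hT (mulmxV uT)) // mul0r.
apply/unitarymxP/mulmx1C.
rewrite !adjmxM -!mulmxA (mulmxA (G^t*)) GE cJ.
have -> : (invmx T)^t* *m (T^t* *m diag_mx d *m T *m (invmx T *m diag_mx c)) =
  diag_mx d *m diag_mx c.
  rewrite -!mulmxA (mulmxA T) mulmxV // mul1mx (mulmxA _ (T^t*)) -adjmxM.
  by rewrite mulmxV // adjmx1 mul1mx.
rewrite !mulmx_diag (_ : \row_i _ = const_mx 1) ?diag_const_mx //.
apply/rowP => i; rewrite !mxE -{2}[d 0 i]sqrtCK expr2.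
by field; rewrite sqrtC_eq0 gt_eqF.
Qed.

(** Under a triangular change of basis, nonzero entries spread only towards larger indices. *)
Lemma tri_congr_support m n (L : 'M[C]_m) (K : 'M[C]_n) (A : 'M[C]_(m, n)) a b :
  trimx L -> trimx K -> (L^t* *m A *m K) a b != 0 ->
  exists (i : 'I_m) (j : 'I_n), [/\ (i <= a)%N, (j <= b)%N & A i j != 0].
Proof.
move=> hL hK; apply: contraNP => hN; rewrite mxE big1 // => j _.
have [bj|jb] := ltnP b j; first by rewrite hK // mulr0.
rewrite mxE big1 ?mul0r // => i _; rewrite adjmxE.
have [ai|ia] := ltnP a i; first by rewrite hL // conjC0 mul0r.
have [->|Aij] := eqVneq (A i j) 0; first by rewrite mulr0.
by case: hN; exists i, j.
Qed.

Lemma congr_mulmx m n (H L : 'M[C]_m) (A : 'M[C]_(m, n)) (G K : 'M[C]_n) :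
  (H *m L)^t* *m A *m (G *m K) = L^t* *m (H^t* *m A *m G) *m K.
Proof. by rewrite adjmxM !mulmxA. Qed.

End Triangular.

(** * Recession directions of the objective *)

Section Recession.
Variable R : realType.
Local Notation C := R[i].

Lemma sqr_norm_Re (c : C) : `|c| ^+ 2 = (complex.Re (`|c| ^+ 2))%:C.
Proof. by rewrite RRe_real // ger0_real // exprn_ge0. Qed.

Lemma Re_sqr_norm_ge0 (c : C) : 0 <= complex.Re (`|c| ^+ 2).
Proof. by rewrite -ler0c -sqr_norm_Re exprn_ge0. Qed.

Lemma trace_kraus_exp m n p (A : 'I_p -> 'M[C]_(m, n)) (U : 'M[C]_n) (V : 'M[C]_m)
    (x : 'I_n -> R) (y : 'I_m -> R) :
  \tr (kraus_map A (exp_conj U x) *m exp_conj V y) =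
  (\sum_l \sum_a \sum_b
     complex.Re (`|(V^t* *m A l *m U) a b| ^+ 2) * (expR (x b) * expR (y a)))%:C.
Proof.
rewrite /kraus_map mulmx_suml raddf_sum rmorph_sum /=; apply: eq_bigr => l _.
rewrite trace_kraus_diag rmorph_sum; apply: eq_bigr => a _.
rewrite rmorph_sum; apply: eq_bigr => b _.
by rewrite !mxE !rmorphM /= -sqr_norm_Re.
Qed.

Lemma perm_image_rev (T : eqType) n (f : 'I_n -> T) :
  perm_eq [seq f (rev_ord i) | i : 'I_n] [seq f i | i : 'I_n].
Proof.
rewrite -(map_image_comp f (@rev_ord n)); apply: perm_map.
apply: uniq_perm; rewrite ?enum_uniq //.
  by rewrite map_inj_uniq ?enum_uniq //; apply: rev_ord_inj.
move=> i; rewrite mem_enum; apply/mapP; exists (rev_ord i).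
  by rewrite mem_enum.
by rewrite rev_ordK.
Qed.

Lemma dotrZ n (t : R) (u v : 'rV[R]_n) : dotr u (t *: v) = t * dotr u v.
Proof. by rewrite /dotr big_distrr; apply: eq_bigr => i _; rewrite mxE mulrCA. Qed.

Lemma cap_le_obj m n p (A : 'I_p -> 'M[C]_(m, n)) (alpha : 'rV[R]_n)
    (beta : 'rV[R]_m) (k : R) (XYz : 'M[C]_n * 'M[C]_m * R) :
  @cap_dom R n m XYz -> (cap A alpha beta k <= (cap_obj A alpha beta k XYz)%:E)%E.
Proof. by move=> hXYz; apply: ereal_inf_lbound; exists XYz. Qed.

(* Along X_t = U exp(t x) U^*, Y_t = V exp(t y) V^*, z_t = t z the trace term
   stays bounded as soon as z <= x_j + y_i on the support of the Kraus
   operators, so a negative slope of the linear part would force cap = -oo. *)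
Lemma cap_recession m n p (A : 'I_p -> 'M[C]_(m, n)) (alpha : 'rV[R]_n)
    (beta : 'rV[R]_m) (k : R) (G : 'M[C]_n) (H : 'M[C]_m)
    (x : 'rV[R]_n) (y : 'rV[R]_m) (z : R) :
  G \in unitmx -> H \in unitmx -> cap A alpha beta k <> -oo%E ->
  nonincreasing_vec x -> nonincreasing_vec y ->
  (forall i, 0 <= x 0 i) -> (forall i, 0 <= y 0 i) -> 0 <= z ->
  (forall l i j, (H^t* *m A l *m G) i j != 0 ->
     z <= x 0 (rev_ord j) + y 0 (rev_ord i)) ->
  k * z <= dotr alpha x + dotr beta y.
Proof.
move=> uG uH capN hx hy x0 y0 z0 supp.
have [K hK uU] := unitary_triangular uG.
have [L hL uV] := unitary_triangular uH.
set U := G *m K in uU; set V := H *m L in uV.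
rewrite leNgt; apply/negP => slope.
pose N l a b := complex.Re (`|(V^t* *m A l *m U) a b| ^+ 2).
pose c0 := \sum_l \sum_a \sum_b N l a b.
pose delta := dotr alpha x + dotr beta y - k * z.
have cap_le t : 0 <= t -> (cap A alpha beta k <= (c0 + t * delta)%:E)%E.
  (* Reversed exponents are nondecreasing along the flags, so the bound on [z] passes from the
     support in the bases [G], [H] to the larger indices where the unitary frames have nonzero
     entries. *)
  move=> t0; pose xt i := t * x 0 (rev_ord i); pose yt i := t * y 0 (rev_ord i).
  apply: (@le_trans _ _
    (cap_obj A alpha beta k (exp_conj U xt, exp_conj V yt, t * z))%:E).
    apply: cap_le_obj.
    have [hX X1] := exp_conj_dom uU (fun i => mulr_ge0 t0 (x0 (rev_ord i))).
    have [hY Y1] := exp_conj_dom uV (fun i => mulr_ge0 t0 (y0 (rev_ord i))).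
    by split=> //; rewrite mulr_ge0.
  have xE : eigvals (logmx (exp_conj U xt)) = t *: x.
    apply: eigvals_log_exp_conj => // [i j ij|].
      by rewrite !mxE ler_wpM2l // hx.
    rewrite (eq_image_fun (g := fun i => (t *: x) 0 (rev_ord i))) => [|i].
      exact: perm_image_rev (fun i => (t *: x) 0 i).
    by rewrite mxE.
  have yE : eigvals (logmx (exp_conj V yt)) = t *: y.
    apply: eigvals_log_exp_conj => // [i j ij|].
      by rewrite !mxE ler_wpM2l // hy.
    rewrite (eq_image_fun (g := fun i => (t *: y) 0 (rev_ord i))) => [|i].
      exact: perm_image_rev (fun i => (t *: y) 0 i).
    by rewrite mxE.
  rewrite lee_fin /cap_obj xE yE !dotrZ !inv_exp_conj // trace_kraus_exp.
  rewrite (_ : forall r : R, complex.Re r%:C = r) //.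
  rewrite -!addrA lerD //; last by rewrite /delta; lra.
  rewrite /c0 big_distrl; apply: ler_sum => l _.
  rewrite big_distrl; apply: ler_sum => a _.
  rewrite big_distrl; apply: ler_sum => b _.
  change (N l a b * (expR (- xt b) * expR (- yt a)) * expR (t * z) <= N l a b).
  have [B0|B0] := eqVneq ((V^t* *m A l *m U) a b) 0.
    have N0 : N l a b = 0 by rewrite /N B0 normr0 expr0n.
    by rewrite N0 !mul0r.
  have [i [j [ia jb Aij]]] : exists (i : 'I_m) (j : 'I_n),
      [/\ (i <= a)%N, (j <= b)%N & (H^t* *m A l *m G) i j != 0].
    by apply: (tri_congr_support hL hK); rewrite -congr_mulmx.
  have zxy : z <= x 0 (rev_ord b) + y 0 (rev_ord a).
    apply: le_trans (supp _ _ _ Aij) _.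
    by apply: lerD; [apply: hx|apply: hy]; rewrite /= leq_sub2l.
  rewrite -mulrA ler_piMr ?Re_sqr_norm_ge0 // -!expRD -[leRHS]expR0 ler_expR /xt /yt.
  nra.
have [r capr] : exists r : R, cap A alpha beta k = r%:E.
  have := cap_le 0 (lexx _); move: capN.
  by case: (cap A alpha beta k) => // r _ _; exists r.
have d0 : delta < 0 by rewrite /delta subr_lt0.
have rle t : 0 <= t -> r <= c0 + t * delta by move/cap_le; rewrite capr lee_fin.
have r0 : r <= c0 by have := rle 0 (lexx _); rewrite mul0r addr0.
(* At this [t] the upper bound equals [r - 1], which is below the infimum [r]. *)
have := rle ((c0 - r + 1) / (- delta)).
rewrite invrN mulrN mulNr divfK ?lt_eqF //.
have -> : 0 <= - ((c0 - r + 1) / delta).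
  by rewrite -mulrN -invrN divr_ge0 //; lra.
by move=> /(_ isT); lra.
Qed.

End Recession.

(** * Inverses and leading minors in a reduced basis *)

Section ReducedForm.
Variable C : numClosedFieldType.

Lemma inv_congr_diag n (X G T : 'M[C]_n) (d e : 'rV[C]_n) :
  G \in unitmx -> T \in unitmx -> (forall i, e 0 i * d 0 i = 1) ->
  G^t* *m X *m G = T^t* *m diag_mx d *m T ->
  invmx X = (G *m invmx T) *m diag_mx e *m (G *m invmx T)^t*.
Proof.
move=> uG uT de GX; set W := G *m invmx T.
have uW : W \in unitmx by rewrite unitmx_mul uG unitmx_inv.
have WX : W^t* *m X *m W = diag_mx d.
  rewrite /W adjmxM -!mulmxA (mulmxA X) (mulmxA (G^t*)) (mulmxA (G^t*)) GX.
  rewrite -!mulmxA mulmxV // mulmx1 mulmxA -adjmxM mulmxV // adjmx1 mul1mx //.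
have ZX : W *m diag_mx e *m W^t* *m X = 1%:M.
  rewrite -[LHS](mulmxK uW) -(mulmxA _ X W) -(mulmxA _ (W^t*)) (mulmxA (W^t*)) WX.
  rewrite -(mulmxA W) mulmx_diag (_ : \row_i _ = const_mx 1).
    by rewrite diag_const_mx mulmx1 mulmxV.
  by apply/rowP => i; rewrite !mxE de.
have [_ uX] := mulmx1_unit ZX.
by rewrite -[LHS]mul1mx -ZX mulmxK.
Qed.

Lemma det_unitary_diag n (U : 'M[C]_n) (l : 'rV[C]_n) : U \is unitarymx ->
  \det (U *m diag_mx l *m U^t*) = \prod_i l 0 i.
Proof.
move=> /unitarymxP uU.
by rewrite !det_mulmx mulrAC -det_mulmx uU det1 mul1r det_diag.
Qed.

(** Replacing [B] by its coordinates in the frame [U] keeps its Gram determinant and turns the form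
    into the weights [l]. With positive pivots, the second conclusion excludes a zero Gram
    determinant. *)
Lemma leading_ldl_ge n s (hs : (s <= n)%N) (U G T : 'M[C]_n) (l d : 'rV[C]_n) (mu : C)
    (B := colsub (widen_ord hs) G) :
  U \is unitarymx -> unitriu T ->
  G^t* *m (U *m diag_mx l *m U^t*) *m G = T^t* *m diag_mx d *m T ->
  (forall f : 'I_s -> 'I_n, injective f -> mu <= \prod_r l 0 (f r)) ->
  mu * \det (B^t* *m B) <= \prod_(r < s) d 0 (widen_ord hs r) /\
  (\det (B^t* *m B) = 0 -> \prod_(r < s) d 0 (widen_ord hs r) = 0).
Proof.
move=> /unitarymxP uU hT GX hmu; rewrite -(det_leading_ldl hs hT GX) -/B.
have -> : B^t* *m (U *m diag_mx l *m U^t*) *m B =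
    (U^t* *m B)^t* *m diag_mx l *m (U^t* *m B) by rewrite adjmxM trmxCK !mulmxA.
have -> : B^t* *m B = (U^t* *m B)^t* *m (U^t* *m B).
  by rewrite adjmxM trmxCK mulmxA -(mulmxA _ U) uU mulmx1.
by split; [exact: le_det_weighted_gram|exact: det_gram_eq0].
Qed.

Lemma loewner1_coercive n (X : 'M[C]_n) :
  (forall v : 'cV[C]_n, 0 <= (v^t* *m (X - 1%:M) *m v) 0 0) -> coercive 1 X.
Proof.
move=> X1 v; have := X1 v; rewrite mulmxBr mulmxBl mxE [Z in _ + Z]mxE subr_ge0.
by rewrite mulmx1 mul1r.
Qed.

Lemma congr_mulmxK m n (H S : 'M[C]_m) (A : 'M[C]_(m, n)) (G T : 'M[C]_n) :
  S \in unitmx -> T \in unitmx ->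
  S^t* *m ((H *m invmx S)^t* *m A *m (G *m invmx T)) *m T = H^t* *m A *m G.
Proof.
move=> uS uT; rewrite adjmxM !mulmxA -adjmxM mulVmx // adjmx1 mul1mx.
by rewrite mulmxKV.
Qed.

End ReducedForm.

(** * Logarithms of the pivots against the spectrum *)

Section Exponents.
Variable R : realType.
Local Notation C := R[i].

Lemma prod_expC (I : finType) (F : I -> R) :
  \prod_i (expR (F i))%:C = (expR (\sum_i F i))%:C.
Proof. by rewrite expR_sum rmorph_prod. Qed.

(** The Gram determinant of the first [t] columns of [G] is a nonzero Gaussian integer and
    nonnegative, hence at least 1, so the first [t] pivots multiply to at least the product of the
    [t] smallest eigenvalues. The totals agree because [G] and [T] have determinants of modulus
    1. *)
Lemma reduced_majorized n (X U G T : 'M[C]_n) (s xi : 'I_n -> R) :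
  U \is unitarymx -> X = exp_conj U s -> unimodular G -> unitriu T ->
  G^t* *m X *m G = T^t* *m diag_mx (\row_i (expR (xi i))%:C) *m T ->
  (forall i j : 'I_n, (i <= j)%N -> s j <= s i) ->
  \sum_i xi i = \sum_i s i /\
  forall t, (t <= n)%N ->
    \sum_(i < n | (n - t <= i)%N) s i <= \sum_(i < n | (i < t)%N) xi i.
Proof.
move=> uU XE hG hT GX hs; rewrite XE in GX; split.
  have := congr1 determinant GX; rewrite !det_mulmx mulrAC det_adjmx.
  rewrite [_^* * _]mulrC -normCK hG.2 expr1n mul1r -!det_mulmx det_unitary_diag //.
  rewrite !det_mulmx det_adjmx unitriu_det // conjC1 mul1r mulr1 det_diag.
  under eq_bigr do rewrite mxE; under [X in _ = X]eq_bigr do rewrite mxE.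
  by rewrite !prod_expC => /complexI /expR_inj.
move=> t tn; pose sn (i : nat) := oapp s 0 (insub i).
have snE (i : 'I_n) : sn i = s i by rewrite /sn valK.
have sn_noninc i j : (i <= j)%N -> (j < n)%N -> sn j <= sn i.
  move=> ij jn; have i_n := leq_ltn_trans ij jn.
  by rewrite (snE (Ordinal jn)) (snE (Ordinal i_n)) hs.
pose mu : C := (expR (\sum_(i < n | (n - t <= i)%N) s i))%:C.
have hmu (f : 'I_t -> 'I_n) : injective f ->
    mu <= \prod_r (\row_i (expR (s i))%:C : 'rV[C]_n) 0 (f r).
  move=> inj_f; under eq_bigr do rewrite mxE.
  rewrite prod_expC lecR ler_expR.
  have := sum_smallest_le sn_noninc inj_f.
  under eq_bigr do rewrite snE; by under [X in _ <= X]eq_bigr do rewrite snE.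
have [le_mu nz] := leading_ldl_ge tn uU hT GX hmu.
set B := colsub _ G in le_mu nz.
have prodE : \prod_(r < t) (\row_i (expR (xi i))%:C : 'rV[C]_n) 0 (widen_ord tn r) =
    (expR (\sum_(i < n | (i < t)%N) xi i))%:C.
  under eq_bigr do rewrite mxE.
  by rewrite prod_expC (big_ord_narrow tn).
rewrite prodE in le_mu nz.
have gB : gmx B by move=> i j; rewrite mxE; apply hG.1.
have detB0 : 0 <= \det (B^t* *m B) by apply: det_gram_ge0.
have detB1 : 1 <= \det (B^t* *m B).
  rewrite -(ger0_norm detB0) norm_gint_ge1 //.
    by apply: gmx_det; apply: gmxM => //; apply: gmx_adj.
  by apply/eqP => /nz /eqP; rewrite eq_complex /= gt_eqF ?expR_gt0.
have mu0 : 0 <= mu by rewrite ler0c expR_ge0.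
have : mu <= (expR (\sum_(i < n | (i < t)%N) xi i))%:C.
  by apply: le_trans le_mu; rewrite ler_peMr.
by rewrite lecR ler_expR.
Qed.

(** Here [x] is the vector of log pivots in reversed order, nonincreasing up to [n * ln 4], and [w]
    is its water-filled correction in the cone, majorized by the spectrum of [logmx X]. *)
Lemma reduced_exponents n (X : 'M[C]_n) : (0 < n)%N ->
  X \is hermsymmx -> loewner_le 1%:M X ->
  exists (G T : 'M[C]_n) (x w : 'rV[R]_n),
    [/\ [/\ unimodular G, unitriu T, forall i j, `|T i j| <= 1 &
            invmx X = exp_conj (G *m invmx T) (fun i => - x 0 (rev_ord i))],
        forall i j : 'I_n, (i <= j)%N ->
          x 0 (rev_ord i) <= x 0 (rev_ord j) + n%:R * ln 4,
        forall i, x 0 i <= w 0 i + n%:R * ln 4,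
        nonincreasing_vec w /\ forall i, 0 <= w 0 i &
        forall alpha, nonincreasing_vec alpha ->
          dotr alpha w <= dotr alpha (eigvals (logmx X))].
Proof.
case: n X => // n X _ hX X1.
have [U uU [XE hs s0]] := spectral_decomposition hX X1.
set s := eigvals (logmx X) in XE hs s0 *.
have [G [T [d [hG [hT T1] d0 dle GX]]]] :=
  lattice_reduction ltr01 (elimT (hermP _) hX) (loewner1_coercive X1.2).
pose xi i := ln (complex.Re (d 0 i)).
have dR i : d 0 i = (complex.Re (d 0 i))%:C by rewrite RRe_real // gtr0_real.
have dE i : d 0 i = (expR (xi i))%:C.
  by rewrite {1}dR lnK // posrE -ltcR -dR.
have dE' : d = \row_i (expR (xi i))%:C by apply/rowP => i; rewrite mxE dE.
rewrite dE' in GX.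
pose c : R := n.+1%:R * ln 4.
have ln4 : 0 <= ln 4 :> R by rewrite ln_ge0 // ler1n.
have xi_le (i j : 'I_n.+1) : (i <= j)%N -> xi i <= xi j + c.
  move=> ij; have := dle i j ij; rewrite !dE.
  rewrite -[4](rmorph_nat (real_complex R)) -rmorphXn -rmorphM lecR.
  rewrite -[4%:R](@lnK R) ?posrE ?ltr0n // -expRM_natl -expRD ler_expR => h.
  apply: (le_trans h); rewrite addrC lerD2l /c ler_wpM2r // ler_nat.
  by rewrite (leq_trans (leq_subr _ _)) // ltnW.
have [sum_eq tail_le] := reduced_majorized uU XE hG hT GX hs.
pose x : 'rV[R]_n.+1 := \row_i xi (rev_ord i).
pose nf (u : 'rV[R]_n.+1) (i : nat) := u 0 (inord i).
have nfE (u : 'rV[R]_n.+1) (i : 'I_n.+1) : nf u i = u 0 i by rewrite /nf inord_val.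
have sumE (u : 'rV[R]_n.+1) : \sum_(i < n.+1) nf u i = \sum_i u 0 i.
  by apply: eq_bigr => i _; rewrite nfE.
have tot : \sum_(i < n.+1) nf x i = \sum_(i < n.+1) nf s i.
  rewrite !sumE -sum_eq (reindex_inj rev_ord_inj) /=.
  by apply: eq_bigr => i _; rewrite mxE rev_ordK.
have prefE t (u : 'rV[R]_n.+1) : (t <= n.+1)%N -> \sum_(i < t) nf u i =
    \sum_(i < n.+1) nf u i - \sum_(i < n.+1 | (t <= i)%N) u 0 i.
  move=> tn; rewrite (big_ord_widen _ _ tn).
  rewrite [X in _ = X - _](bigID (fun i : 'I_n.+1 => (i < t)%N)) /=.
  rewrite -addrA -[LHS]addr0; congr (_ + _); apply/esym/eqP; rewrite subr_eq0; apply/eqP.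
  by apply: eq_big => [i|i _]; rewrite -?leqNgt ?nfE.
(* Lower bounds on the leading pivots become upper bounds on prefixes of the reversed vector, since
   the totals are equal. *)
have pref t : (t <= n.+1)%N -> \sum_(i < t) nf x i <= \sum_(i < t) nf s i.
  move=> tn; rewrite (prefE t x tn) (prefE t s tn) tot lerD2l lerN2.
  have := tail_le (n.+1 - t)%N (leq_subr _ _); rewrite subKn // => /le_trans; apply.
  rewrite [X in _ <= X](reindex_inj rev_ord_inj) /= le_eqVlt; apply/orP; left; apply/eqP.
  apply: eq_big => [i|i _]; last by rewrite mxE rev_ordK.
  by have := ltn_ord i; lia.
have hsn i j : (i <= j)%N -> (j < n.+1)%N -> nf s j <= nf s i.
  by move=> ij jn; apply: hs; rewrite !inordK // (leq_ltn_trans ij).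
have hxn i j : (i <= j)%N -> (j < n.+1)%N -> nf x j <= nf x i + c.
  move=> ij jn; rewrite /nf !mxE; apply: xi_le => /=.
  by rewrite !inordK ?(leq_ltn_trans ij) // leq_sub2l.
have [y [hy y0 ys ytot xy]] :=
  water_filling (ltn0Sn n) hsn (fun i _ => s0 (inord i)) pref tot hxn.
exists G, T, x, (\row_i y i); split.
- split=> //; rewrite /exp_conj.
  rewrite (@inv_congr_diag _ _ X G T (\row_i (expR (xi i))%:C)
    (\row_i (expR (- x 0 (rev_ord i)))%:C)) //.
  + exact: unimodular_unit.
  + exact: unitriu_unit.
  + by move=> i; rewrite !mxE rev_ordK -rmorphM -expRD addNr expR0.
- by move=> i j ij; rewrite !mxE !rev_ordK; apply: xi_le.
- by move=> i; rewrite mxE -nfE; apply: xy.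
- by split=> [i j ij|i]; rewrite !mxE; [apply: hy|apply: y0].
move=> alpha halpha.
have := @majorization_le R n.+1 (nf alpha) y (nf s).
have dE2 (u : nat -> R) (v : 'rV[R]_n.+1) : (forall i : 'I_n.+1, u i = v 0 i) ->
    \sum_(i < n.+1) nf alpha i * u i = dotr alpha v.
  by move=> uv; apply: eq_bigr => i _; rewrite nfE uv.
rewrite (dE2 y (\row_i y i)) => [|i]; last by rewrite mxE.
rewrite (dE2 (nf s) s) => [|i]; last exact: nfE.
apply=> // i j ij jn; apply: halpha.
by rewrite !inordK // (leq_ltn_trans ij).
Qed.

End Exponents.

(** * Lower bound on the objective and the resulting capacity bound *)

Section CapacityBound.
Variable R : realType.
Local Notation C := R[i].

(** The trace of [kraus_map A (exp_conj U x) *m exp_conj V y] as a real sum. *)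
Definition kraus_weight m n p (A : 'I_p -> 'M[C]_(m, n)) (U : 'M[C]_n) (V : 'M[C]_m)
    (x : 'I_n -> R) (y : 'I_m -> R) : R :=
  \sum_l \sum_a \sum_b
     complex.Re (`|(V^t* *m A l *m U) a b| ^+ 2) * (expR (x b) * expR (y a)).

Lemma kraus_weight_ge0 m n p (A : 'I_p -> 'M[C]_(m, n)) U V x y :
  0 <= kraus_weight A U V x y.
Proof.
apply: sumr_ge0 => l _; apply: sumr_ge0 => a _; apply: sumr_ge0 => b _.
by rewrite !mulr_ge0 ?Re_sqr_norm_ge0 ?expR_ge0.
Qed.

(** A nonzero entry in the integral bases has modulus at least 1, so the triangular entry bound
    applies to the operator [A l]; the other operators contribute nonnegatively. *)
Lemma kraus_weight_lower m n p (A : 'I_p -> 'M[C]_(m, n)) (G T : 'M[C]_n)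
    (H S : 'M[C]_m) (x : 'I_n -> R) (y : 'I_m -> R) (cx cy : R) l i j :
  (forall l i j, gaussian_integer (A l i j)) -> unimodular G -> unimodular H ->
  unitriu T -> unitriu S ->
  (forall i j, `|T i j| <= 1) -> (forall i j, `|S i j| <= 1) ->
  (forall i j : 'I_n, (i <= j)%N -> x j <= x i + cx) ->
  (forall i j : 'I_m, (i <= j)%N -> y j <= y i + cy) ->
  (H^t* *m A l *m G) i j != 0 ->
  expR (x j + y i) <= (m * n)%:R ^+ 2 * expR (cx + cy) *
    kraus_weight A (G *m invmx T) (H *m invmx S) x y.
Proof.
move=> gA hG hH hT hS T1 S1 hx hy nz.
pose B := (H *m invmx S)^t* *m A l *m (G *m invmx T).
have BE : S^t* *m B *m T = H^t* *m A l *m G.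
  by rewrite congr_mulmxK ?unitriu_unit.
have A1 : 1 <= `|(S^t* *m B *m T) i j|.
  have gB : gmx (H^t* *m A l *m G).
    by apply: gmxM _ hG.1; apply: gmxM; [exact: gmx_adj hH.1|exact: gA].
  by rewrite BE; apply: norm_gint_ge1.
pose p' : 'rV[C]_n := \row_b (expR (x b))%:C.
pose q' : 'rV[C]_m := \row_a (expR (y a))%:C.
have := @tri_entry_bound _ _ _ S T B p' q' (expR cx)%:C (expR cy)%:C i j
  hS hT S1 T1 _ _ _ _ A1.
have -> : \sum_a \sum_b `|B a b| ^+ 2 * (p' 0 b * q' 0 a) =
  (\sum_a \sum_b complex.Re (`|B a b| ^+ 2) * (expR (x b) * expR (y a)))%:C.
  rewrite rmorph_sum; apply: eq_bigr => a _; rewrite rmorph_sum; apply: eq_bigr => b _.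
  by rewrite [p' _ _]mxE [q' _ _]mxE sqr_norm_Re !rmorphM.
rewrite !mxE -(rmorph_nat (real_complex R)) -rmorphXn -!rmorphM lecR -!expRD.
move=> le_l; apply: (@le_trans _ _ ((m * n)%:R ^+ 2 * expR (cx + cy) *
    \sum_a \sum_b complex.Re (`|B a b| ^+ 2) * (expR (x b) * expR (y a)))).
  apply: le_l => [b|a|b c bc|a c ac]; rewrite !mxE ?ltcR ?expR_gt0 //.
    by rewrite -rmorphM lecR -expRD ler_expR addrC hx.
  by rewrite -rmorphM lecR -expRD ler_expR addrC hy.
apply: ler_wpM2l; first by rewrite mulr_ge0 ?exprn_ge0 ?expR_ge0.
rewrite /kraus_weight [leRHS](bigD1 l) //= lerDl.
apply: sumr_ge0 => l' _; apply: sumr_ge0 => a _; apply: sumr_ge0 => b _.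
by rewrite !mulr_ge0 ?Re_sqr_norm_ge0 ?expR_ge0.
Qed.

(** [expR s - k * s] is smallest at [s = ln k], with value [k - k * ln k]; the positive [k] is
    dropped. *)
Lemma entropy_bound (k s : R) : 0 < k -> k * s - k * ln k <= expR s.
Proof.
move=> k0; have := expR_ge1Dx (s - ln k).
rewrite expRD expRN lnK // => h.
have : k * (1 + (s - ln k)) <= k * (expR s / k) by rewrite ler_pM2l.
by rewrite mulrCA divff ?gt_eqF // mulr1; lra.
Qed.

(** Logarithm of the total loss: [(n + m) * ln 4] once for comparing entries and once for passing to
    the cone, and [2 * ln (m * n)] for the number of entries. *)
Definition reduction_cost (m n : nat) : R :=
  2 * ((n + m)%:R * ln 4) + 2 * ln (m * n)%:R.

Lemma cap_obj_lower m n p (A : 'I_p -> 'M[C]_(m, n)) (alpha : 'rV[R]_n)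
    (beta : 'rV[R]_m) (k : R) (XYz : 'M[C]_n * 'M[C]_m * R) :
  (0 < n)%N -> (0 < m)%N -> (forall l i j, gaussian_integer (A l i j)) ->
  nonincreasing_vec alpha -> nonincreasing_vec beta -> 0 <= k ->
  cap A alpha beta k <> -oo%E -> @cap_dom R n m XYz ->
  - (k * ln k + k * reduction_cost m n) <= cap_obj A alpha beta k XYz.
Proof.
move=> n0 m0 gA halpha hbeta k0 capN; case: XYz => [[X Y] z] [hX hY X1 Y1 z0].
have [G [T [x [w [[hG hT T1 XE] xle xw [hw w0] wX]]]]] := reduced_exponents n0 hX X1.
have [H [S [y [v [[hH hS S1 YE] yle yv [hv v0] vY]]]]] := reduced_exponents m0 hY Y1.
have rec t : 0 <= t -> (forall l i j, (H^t* *m A l *m G) i j != 0 ->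
     t <= w 0 (rev_ord j) + v 0 (rev_ord i)) ->
     k * t <= dotr alpha (eigvals (logmx X)) + dotr beta (eigvals (logmx Y)).
  move=> t0 supp; apply: le_trans (lerD (wX _ halpha) (vY _ hbeta)).
  exact: (cap_recession (unimodular_unit hG) (unimodular_unit hH) capN).
rewrite /cap_obj XE YE trace_kraus_exp -/(kraus_weight _ _ _ _ _).
rewrite (_ : forall r : R, complex.Re r%:C = r) //.
set W := kraus_weight _ _ _ _ _; set E1 := dotr alpha _; set E2 := dotr beta _.
have W0 : 0 <= W by apply: kraus_weight_ge0.
have We : 0 <= W * expR z by rewrite mulr_ge0 ?expR_ge0.
(* For [k = 0] the recession bound at [t = 0] already makes the linear part nonnegative. *)
have [kE|kN0] := eqVneq k 0.
  have := rec 0 (lexx _) (fun l i j _ => addr_ge0 (w0 _) (v0 _)).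
  by rewrite -/E1 -/E2 kE !mul0r; lra.
have kp : 0 < k by rewrite lt_neqAle eq_sym kN0.
pose nz (lij : 'I_p * 'I_m * 'I_n) := (H^t* *m A lij.1.1 *m G) lij.1.2 lij.2 != 0.
(* With empty support, the recession bound for zero exponents and [z = 1] would give [k <= 0]. *)
have [/existsP [o nzo]|] := boolP [exists lij, nz lij]; last first.
  rewrite negb_exists => /forallP none.
  have capN' := cap_recession (unimodular_unit hG) (unimodular_unit hH) capN.
  have : k * 1 <= dotr alpha 0 + dotr beta 0.
    apply: capN' => // [i j _|i j _|i|i|l i j nzl]; rewrite ?mxE //.
    by have /negP := none (l, i, j).
  by rewrite /dotr !big1 => [|i _|i _]; rewrite ?mxE ?mulr0 //; lra.
pose F (lij : 'I_p * 'I_m * 'I_n) := w 0 (rev_ord lij.2) + v 0 (rev_ord lij.1.2).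
case: (@Order.TotalTheory.arg_minP _ _ _ o nz F nzo) => -[[l i] j] nzl minl.
pose tau := F (l, i, j).
have tau0 : 0 <= tau by rewrite addr_ge0.
have ktau : k * tau <= E1 + E2.
  by apply: rec => // l' i' j' nz'; apply: (minl (l', i', j')).
have := @kraus_weight_lower _ _ _ A G T H S (fun i => - x 0 (rev_ord i))
  (fun i => - y 0 (rev_ord i)) (n%:R * ln 4) (m%:R * ln 4) l i j gA hG hH hT hS T1 S1.
move=> /(_ _ _ nzl); rewrite -/W => lowW.
have {}lowW : expR (- tau - reduction_cost m n) <= W.
  have mn0 : 0 < (m * n)%:R :> R by rewrite ltr0n muln_gt0 m0.
  have : expR (- x 0 (rev_ord j) - y 0 (rev_ord i)) <=
      (m * n)%:R ^+ 2 * expR (n%:R * ln 4 + m%:R * ln 4) * W.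
    by apply: lowW => a b ab; [have := xle a b ab|have := yle a b ab]; lra.
  have -> : (m * n)%:R ^+ 2 = expR (2 * ln (m * n)%:R) :> R.
    by rewrite -[in LHS](lnK (x := (m * n)%:R)) ?posrE // -expRM_natl.
  rewrite -expRD mulrC -ler_pdivrMr ?expR_gt0 // -expRN -expRD.
  apply: le_trans; rewrite ler_expR /tau /F /reduction_cost natrD /=.
  by have := xw (rev_ord j); have := yv (rev_ord i); lra.
have lowz : expR (z - tau - reduction_cost m n) <= W * expR z.
  rewrite (_ : z - _ - _ = (- tau - reduction_cost m n) + z); last by ring.
  by rewrite expRD ler_pM2r ?expR_gt0.
(* The terms in [z] and [tau] cancel against [- k * z] and the bound [ktau]. *)
have := entropy_bound (z - tau - reduction_cost m n) kp.
by rewrite !mulrBr; lra.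
Qed.

(** With [N = n + m >= 2], both [ln 4] and [ln (m * n)] are at most [2 * ln N], so each of the two
    summands costs at most [4 * N * ln N]. *)
Lemma reduction_cost_le m n : (0 < n)%N -> (0 < m)%N ->
  reduction_cost m n <= 8 * ((n + m)%:R * ln (m + n)%:R).
Proof.
move=> n0 m0; rewrite /reduction_cost [(m + n)%N]addnC.
have N2 : (2 <= n + m)%N by lia.
have N0 : 0 < (n + m)%:R :> R by rewrite ltr0n; lia.
have N1 : 1 <= (n + m)%:R :> R by rewrite ler1n; lia.
have ln2 : ln 2 <= ln (n + m)%:R :> R by rewrite ler_ln ?posrE // (ler_nat R 2).
have ln20 : 0 <= ln 2 :> R by rewrite ln_ge0 // ler1n.
have ln4 : ln 4 = 2 * ln 2 :> R.
  have -> : 4 = 2 ^+ 2 :> R by rewrite -natrX.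
  by rewrite lnXn // mulr_natl.
have lnmn : ln (m * n)%:R <= 2 * ln (n + m)%:R :> R.
  rewrite mulr_natl -lnXn // ler_ln ?posrE ?exprn_gt0 ?ltr0n ?muln_gt0 ?addn_gt0 ?m0 ?n0 //.
  by rewrite -natrX ler_nat; nia.
by rewrite ln4; nra.
Qed.

End CapacityBound.

(** Minimizing over [z] produces the term [k * ln k]. The assumption on [k] bounds [ln k] by [M]
    times the target expression without its factor [k], and adding the reduction cost gives the
    constant [M + 8]. *)
Theorem theorem4p16 (R : realType) :
  forall M : R, exists C : R,
  forall (n m p : nat) (A : 'I_p -> 'M[R[i]]_(m, n))
         (alpha : 'rV[R]_n) (beta : 'rV[R]_m) (k : R),
    (0 < n)%N -> (0 < m)%N -> (0 < p)%N ->
    (forall l i j, gaussian_integer (A l i j)) ->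
    nonincreasing_vec alpha -> nonincreasing_vec beta ->
    0 <= k ->
    k <= expR (M * ((n + m)%:R * ln (m + n)%:R + ln p%:R)) ->
    cap A alpha beta k = -oo%E \/
    (- cap A alpha beta k <=
       (C * (k * (n + m)%:R * ln (m + n)%:R + k * ln p%:R))%:E)%E.
Proof.
move=> M; exists (M + 8) => n m p A alpha beta k n0 m0 p0 gA halpha hbeta k0 kM.
have [capN|/eqP capN] := eqVneq (cap A alpha beta k) -oo%E; [by left|right].
set Q := (n + m)%:R * ln (m + n)%:R in kM.
have lnp : 0 <= ln p%:R :> R by rewrite ln_ge0 // ler1n.
have kln : k * ln k <= k * (M * (Q + ln p%:R)).
  have [->|kN0] := eqVneq k 0; first by rewrite !mul0r.
  have kp : 0 < k by rewrite lt_neqAle eq_sym kN0.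
  by rewrite ler_pM2l // -[leRHS]expRK ler_ln ?posrE ?expR_gt0.
have kcost := ler_wpM2l k0 (reduction_cost_le R n0 m0); rewrite -/Q in kcost.
have klnp : 0 <= k * ln p%:R by rewrite mulr_ge0.
rewrite leeNl -EFinN; apply: le_ereal_inf_tmp => _ [XYz dXYz <-].
rewrite lee_fin; apply: le_trans (cap_obj_lower n0 m0 gA halpha hbeta k0 capN dXYz).
by rewrite lerN2 -mulrA -/Q; lra.
Qed.
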